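(* Let $n,k,n_1,n_2,\dots,n_k$ be positive integers with $n>1$ and $k>1$. Then: \begin{enumerate} \item $\operatorname{MLdeg}(n)=1$ if $n=2$, and $\operatorname{MLdeg}(n)=2^{n-1}-n$ if $n>2$; \item $\operatorname{MLdeg}(n_1,1)=\operatorname{MLdeg}(n_1+1)$; \item $\operatorname{MLdeg}(n_1,n_2,\dots,n_k)=\prod_{i=1}^{k}\operatorname{MLdeg}(n_i,1)$. \end{enumerate}
   Context: Write $[m]=\{1,\dots,m\}$. Let $k\ge 1$ and let $n_1,\dots,n_k$ be positive integers with $n_1+\cdots+n_k\ge 2$. The $\beta$-stochastic blockmodel ($\beta$-SBM) $M=\mathcal{M}(n_1,\dots,n_k)$ has $k$ blocks of vertices $V_i=\{(i,v):1\le v\le n_i\}$, $i\in[k]$, and vertex set $V=\bigcup_i V_i$. The set of potential edges $E$ is the set of all unordered pairs of distinct vertices; the pair $\{(i,v),(j,w)\}$ is written $(i,v)(j,w)$. Points of $\mathbb{C}^{|E|}$ have coordinates $p_{(i,v)(j,w)}=p_{(j,w)(i,v)}$ indexed by $E$. Design matrix: $A$ is the zero-one matrix with columns indexed by $E$, with one row $\beta_{(\ell,x)}$ for each vertex $(\ell,x)\in V$ and one row $\alpha_{\ell_1,\ell_2}$ for each unordered pair of blocks $\ell_1,\ell_2\in[k]$ (with $\ell_1=\ell_2$ allowed). The entry in row $\beta_{(\ell,x)}$ and column $(i,v)(j,w)$ is $1$ if $(\ell,x)\in\{(i,v),(j,w)\}$ and $0$ otherwise; the entry in row $\alpha_{\ell_1,\ell_2}$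 and column $(i,v)(j,w)$ is $1$ if $\{\ell_1,\ell_2\}=\{i,j\}$ and $0$ otherwise. Likelihood equations: given $\mathbf{u}\in\mathbb{C}^{|E|}$, the system $L(M)$ in the unknown $\mathbf{p}\in\mathbb{C}^{|E|}$ consists of the linear equations $A(\mathbf{p}-\mathbf{u})=\mathbf{0}$ together with all quadratic equations of the following types (blocks named by different letters are distinct, and vertices named differently within one block are distinct): - within block: $p_{(i,t)(i,u)}p_{(i,v)(i,w)}-p_{(i,t)(i,v)}p_{(i,u)(i,w)}=0$; - 3-1: $p_{(i,t)(j,w)}p_{(i,u)(i,v)}-p_{(i,t)(i,u)}p_{(i,v)(j,w)}=0$; - 2-2: $p_{(i,t)(j,v)}p_{(i,u)(j,w)}-p_{(i,t)(j,w)}p_{(i,u)(j,v)}=0$; - 2-1-1: $p_{(i,t)(j,v)}p_{(i,u)(l,w)}-p_{(i,t)(l,w)}p_{(i,u)(j,v)}=0$. The quadratic binomials generate the toric ideal $I_A$ of the model. The maximum likelihood degree $\operatorname{MLdeg}(M)=\operatorname{MLdeg}(n_1,\dots,n_k)$ is the number of solutions $\mathbf{p}\in\mathbb{C}^{|E|}$ of $L(M)$ for generic $\mathbf{u}\in\mathbb{C}^{|E|}$ (that is, for $\mathbf{u}$ outside some proper Zariski-closed subset). In particular $\operatorname{MLdeg}(n)$ refers to the model with a single block of $n$ vertices, and $\operatorname{MLdeg}(n_i,1)$ to the model with two blocks, of sizes $n_i$ and $1$. *)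

(* Defs.v *)
From HB Require Import structures.
From mathcomp Require Import all_boot all_order all_algebra.
From mathcomp Require Import mpoly.
From mathcomp Require Import boolp classical_sets cardinality.
From mathcomp Require Import reals.
From mathcomp.real_closed Require Import complex.

Set Implicit Arguments.
Unset Strict Implicit.
Unset Printing Implicit Defensive.

Import GRing.Theory.
Local Open Scope ring_scope.

Section Genericity.
Variables (C : fieldType) (m : nat).

Definition zariski_closed (Z : set 'cV[C]_m) : Prop :=
  exists S : set {mpoly C[m]},
    Z = [set u | forall f, S f -> f.@[fun i => u i ord0] = 0]%classic.

Definition generic (P : 'cV[C]_m -> Prop) : Prop :=
  exists Z : set 'cV[C]_m,
    [/\ zariski_closed Z, Z <> setT & forall u, ~ Z u -> P u].

End Genericity.

Section BetaSBM.
Variables (C : fieldType) (k : nat) (ns : k.-tuple nat).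

Definition vertex : finType := {i : 'I_k & 'I_(tnth ns i)}.

Definition vtx (i : 'I_k) (v : 'I_(tnth ns i)) : vertex := Tagged _ v.

Definition edge : finType := {e : {set vertex} | #|e| == 2}.

(* An unordered pair of blocks, possibly equal, is a set of 1 or 2 blocks. *)
Definition block_pair : finType := {b : {set 'I_k} | 0 < #|b| <= 2}%N.

Definition param : finType := (vertex + block_pair)%type.

(* For e = {(i,v), (j,w)}, [set tag x | x in \val e] is {i, j}. *)
Definition incidence (r : param) (e : edge) : bool :=
  match r with
  | inl x => x \in \val e
  | inr b => \val b == [set tag x | x in \val e]
  end.

Definition design : 'M[C]_(#|param|, #|edge|) :=
  \matrix_(r, c) (incidence (enum_val r) (enum_val c))%:R.

(* The coordinate p_xy; the value 0 at x = y is a convention, as every use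
   below has x != y. *)
Definition coord (p : 'cV[C]_#|edge|) (x y : vertex) : C :=
  if insub [set x; y] is Some e then p (enum_rank (e : edge)) ord0 else 0.

Definition quad_within (p : 'cV[C]_#|edge|) : Prop :=
  forall (i : 'I_k) (t u v w : 'I_(tnth ns i)), uniq [:: t; u; v; w] ->
    coord p (vtx t) (vtx u) * coord p (vtx v) (vtx w)
    - coord p (vtx t) (vtx v) * coord p (vtx u) (vtx w) = 0.

Definition quad_31 (p : 'cV[C]_#|edge|) : Prop :=
  forall (i j : 'I_k) (t u v : 'I_(tnth ns i)) (w : 'I_(tnth ns j)),
    i != j -> uniq [:: t; u; v] ->
    coord p (vtx t) (vtx w) * coord p (vtx u) (vtx v)
    - coord p (vtx t) (vtx u) * coord p (vtx v) (vtx w) = 0.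

Definition quad_22 (p : 'cV[C]_#|edge|) : Prop :=
  forall (i j : 'I_k) (t u : 'I_(tnth ns i)) (v w : 'I_(tnth ns j)),
    i != j -> t != u -> v != w ->
    coord p (vtx t) (vtx v) * coord p (vtx u) (vtx w)
    - coord p (vtx t) (vtx w) * coord p (vtx u) (vtx v) = 0.

Definition quad_211 (p : 'cV[C]_#|edge|) : Prop :=
  forall (i j l : 'I_k) (t u : 'I_(tnth ns i)) (v : 'I_(tnth ns j))
         (w : 'I_(tnth ns l)),
    uniq [:: i; j; l] -> t != u ->
    coord p (vtx t) (vtx v) * coord p (vtx u) (vtx w)
    - coord p (vtx t) (vtx w) * coord p (vtx u) (vtx v) = 0.

Definition likelihood_solution (u p : 'cV[C]_#|edge|) : Prop :=
  [/\ design *m (p - u) = 0,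
      quad_within p, quad_31 p, quad_22 p & quad_211 p].

Definition is_MLdeg (d : nat) : Prop :=
  generic (fun u => [set p | likelihood_solution u p] #= `I_d)%card.

(* Over an infinite field at most one d satisfies is_MLdeg.  The value is 0
   when none does, so MLdeg = d with d > 0 entails is_MLdeg d. *)
Definition MLdeg : nat := xget 0%N is_MLdeg.

End BetaSBM.

(* Main.v *)
Require Import Defs.
From mathcomp Require Import mpoly boolp classical_sets cardinality.
From mathcomp Require Import all_boot all_order all_algebra separable.
From mathcomp Require Import ring zify.
From mathcomp Require Import reals.
From mathcomp.real_closed Require Import complex.

(** One block of n > 2 vertices.  The linear equations fix the vertex sums d_v
    of p, the block total being half their sum.  When no entry of p vanishes,
    the quadrics say that p_vw = th_v th_w.  Put S = sum th, q_v = th_v / S and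
    U = 1 / S^2; then
      q_v (1 - q_v) = d_v U,   sum q = 1,   p_vw = q_v q_w / U.
    For a given U every q_v is one of two roots, exchanged by q -> 1 - q, so the
    product over the 2^n choices of (1 - sum q) is a polynomial in U, called
    [normpoly] below.  Its degree is 2^(n-1) for generic d ([normpoly_top]).  At
    U = 0 the q_v are 0 or 1, and exactly n choices have sum 1; each of these
    factors vanishes to first order, so U^n is the exact power of U dividing the
    polynomial ([normpoly_low]).  There remain 2^(n-1) - n nonzero roots.

    It has to be shown that for generic d these roots are simple, each comes from
    a single choice of q, and no solution is missed.  All of this follows once
    one explicit polynomial [regpoly] in U, with coefficients polynomial in d, is
    separable of full degree; by a resultant this is an open condition on d
    ([generic_separable]), so a single example is enough.  For the example
    ([exists_regular_degrees]) all degrees but one are fixed.  A value of U and a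
    choice of the other q_v determine the remaining degree, and the choices that
    are degenerate occur for finitely many U only, because a suitable norm is a
    nonzero polynomial: it does not vanish at U = -1/4, where the numbers
    sqrt(1 - 4 d_v U) are super-increasing integers.  Hence finitely many values
    of the last degree have to be avoided.  A solution with a zero entry would be
    supported on a star, which forces d_c = sum of the other degrees
    ([solution_neq0]); that is excluded by the coefficient of U^n.

    Several blocks.  Contract the complement of the block V_i to one vertex.  The
    2-2 and 2-1-1 quadrics say that the entries between V_i and its complement
    form a matrix of rank one, so with T_i the sum of these entries
      p_(i,t)(j,v) = P_i(t,None) P_j(v,None) alpha_ij / (T_i T_j),
    where P_i is the contracted solution.  Here alpha_ij and T_i are fixed by the
    linear equations.  So for T_i <> 0 solutions correspond to families of
    solutions on the complete graphs with n_i + 1 vertices ([model_count]), and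
    the degree is the product.  Two vertices give the factor 1, so the product
    formula for blocks of sizes n and 1 is the second claim. *)

Set Implicit Arguments.
Unset Strict Implicit.
Unset Printing Implicit Defensive.

Import Order.TTheory GRing.Theory Num.Theory.
Local Open Scope ring_scope.

(** * Eliminating roots of quadratics by norms *)

Section PolynomialExpressions.
Variable I : finType.

(** Integer polynomials in t, e_i and q_i, kept as syntax so that q_i can be
    eliminated against q_i (t - q_i) = e_i uniformly in all commutative rings:
    the same expression is evaluated in a field, in polynomials over it, and in
    polynomials over multivariate polynomials. *)
Inductive pexp : Type :=
| PT
| PC of int
| PE of I
| PQ of I
| PAdd of pexp & pexp
| PMul of pexp & pexp.

Fixpoint peval (R : comNzRingType) (t : R) (e q : I -> R) (w : pexp) : R :=
  match w with
  | PT => t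
  | PC z => z%:~R
  | PE i => e i
  | PQ i => q i
  | PAdd a b => peval t e q a + peval t e q b
  | PMul a b => peval t e q a * peval t e q b
  end.

Fixpoint qoccurs (j : I) (w : pexp) : bool :=
  match w with
  | PQ i => i == j
  | PAdd a b | PMul a b => qoccurs j a || qoccurs j b
  | _ => false
  end.

Definition psum (s : seq pexp) : pexp := foldr PAdd (PC 0) s.
Definition pprod (s : seq pexp) : pexp := foldr PMul (PC 1) s.

Lemma peval_psum (R : comNzRingType) (t : R) e q (J : Type) (s : seq J)
    (F : J -> pexp) :
  peval t e q (psum [seq F j | j <- s]) = \sum_(j <- s) peval t e q (F j).
Proof. by elim: s => [|j s IH] /=; rewrite ?big_nil ?big_cons ?IH. Qed.

Lemma peval_pprod (R : comNzRingType) (t : R) e q (J : Type) (s : seq J)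
    (F : J -> pexp) :
  peval t e q (pprod [seq F j | j <- s]) = \prod_(j <- s) peval t e q (F j).
Proof. by elim: s => [|j s IH] /=; rewrite ?big_nil ?big_cons ?IH. Qed.

Lemma peval_ext (R : comNzRingType) (t : R) (e e' q q' : I -> R) w :
  e =1 e' -> (forall j, qoccurs j w -> q j = q' j) ->
  peval t e q w = peval t e' q' w.
Proof.
move=> ee; elim: w => [|z|i|i|a IHa b IHb|a IHa b IHb] //= qq.
- exact: qq.
- by rewrite IHa ?IHb // => j oj; apply: qq; rewrite oj ?orbT.
- by rewrite IHa ?IHb // => j oj; apply: qq; rewrite oj ?orbT.
Qed.

Lemma peval_morph (R S : comNzRingType) (f : {rmorphism R -> S}) t e q w :
  f (peval t e q w) = peval (f t) (f \o e) (f \o q) w.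
Proof.
elim: w => //= [z|a <- b <-|a <- b <-]; first by rewrite rmorph_int.
- by rewrite rmorphD.
- by rewrite rmorphM.
Qed.

(** Used with x a power of a linear polynomial, to replace the roots q_i, which
    are algebraic functions, by their truncated power series. *)
Lemma peval_congr (R : comNzRingType) (x t : R) (e e' q : I -> R) w :
  (forall i, exists y, e i = e' i + x * y) ->
  exists y, peval t e q w = peval t e' q w + x * y.
Proof.
move=> ee; elim: w => [|z|i|i|a [y ya] b [z zb]|a [y ya] b [z zb]] /=.
- by exists 0; rewrite mulr0 addr0.
- by exists 0; rewrite mulr0 addr0.
- exact: ee.
- by exists 0; rewrite mulr0 addr0.
- by exists (y + z); rewrite ya zb; ring.
- exists (y * peval t e' q b + z * peval t e' q a + x * y * z).
  by rewrite ya zb; ring.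
Qed.

(** Normal form modulo q_i^2 = t q_i - e_i: the pair (a, b) stands for
    a + b q_i with a and b free of q_i. *)
Fixpoint qsplit (i : I) (w : pexp) : pexp * pexp :=
  match w with
  | PQ j => if j == i then (PC 0, PC 1) else (PQ j, PC 0)
  | PAdd a b =>
      let: (a0, a1) := qsplit i a in let: (b0, b1) := qsplit i b in
      (PAdd a0 b0, PAdd a1 b1)
  | PMul a b =>
      let: (a0, a1) := qsplit i a in let: (b0, b1) := qsplit i b in
      (PAdd (PMul a0 b0) (PMul (PC (-1)) (PMul (PE i) (PMul a1 b1))),
       PAdd (PAdd (PMul a0 b1) (PMul a1 b0)) (PMul PT (PMul a1 b1)))
  | w => (w, PC 0)
  end.

(** (a + b q) (a + b (t - q)) for the normal form a + b q; the symmetric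
    functions of q and t - q are t and e_i. *)
Definition qnorm1 (i : I) (w : pexp) : pexp :=
  let: (a, b) := qsplit i w in
  PAdd (PMul a a) (PAdd (PMul PT (PMul a b)) (PMul (PE i) (PMul b b))).

Definition qnorm (s : seq I) (w : pexp) : pexp := foldr qnorm1 w s.

Lemma peval_qsplit (R : comNzRingType) (t : R) (e q : I -> R) i w :
  q i * (t - q i) = e i ->
  peval t e q w = peval t e q (qsplit i w).1 + peval t e q (qsplit i w).2 * q i.
Proof.
move=> qi; elim: w => [|z|j|j|a + b|a + b] /=.
- by ring.
- by ring.
- by ring.
- by case: eqP => [->|_] /=; ring.
- by case: (qsplit i a) (qsplit i b) => a0 a1 [b0 b1] /= -> ->; ring.
- case: (qsplit i a) (qsplit i b) => a0 a1 [b0 b1] /= -> -> /=.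
  by rewrite -qi; ring.
Qed.

Lemma qoccurs_qsplit i j w :
  (qoccurs j (qsplit i w).1 || qoccurs j (qsplit i w).2) ==> (j != i) && qoccurs j w.
Proof.
elim: w => [|z|k|k|a + b|a + b] //=.
- by case: (k =P i) => [->//|/eqP ki] /=; rewrite orbF; apply/implyP=> /eqP <-;
    rewrite ki eqxx.
- case: (qsplit i a) (qsplit i b) => a0 a1 [b0 b1] /=.
  by do 4!case: (qoccurs j _) => //=; case: (j != i); case: (qoccurs j _); case: (qoccurs j _).
- case: (qsplit i a) (qsplit i b) => a0 a1 [b0 b1] /=.
  by do 4!case: (qoccurs j _) => //=; case: (j != i); case: (qoccurs j _); case: (qoccurs j _).
Qed.

Lemma qoccurs_qnorm1 i j w : qoccurs j (qnorm1 i w) -> (j != i) && qoccurs j w.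
Proof.
move: (qoccurs_qsplit i j w); rewrite /qnorm1; case: (qsplit i w) => a b /= /implyP h.
by move=> H; apply: h; move: H; case: (qoccurs j a); case: (qoccurs j b).
Qed.

Lemma qoccurs_qnorm s j w : qoccurs j (qnorm s w) -> (j \notin s) && qoccurs j w.
Proof.
elim: s => [|i s IH] //= /qoccurs_qnorm1 /andP[ji /IH].
by rewrite inE negb_or ji.
Qed.

(** The other root of the quadratic at the places in A. *)
Definition flip (R : nzRingType) (t : R) (A : {set I}) (q : I -> R) : I -> R :=
  fun i => if i \in A then t - q i else q i.

Lemma flip_root (R : comNzRingType) (t : R) A q i :
  flip t A q i * (t - flip t A q i) = q i * (t - q i).
Proof. by rewrite /flip; case: ifP => _; ring. Qed.

Lemma peval_qnorm1 (R : comNzRingType) (t : R) (e q : I -> R) i w :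
  q i * (t - q i) = e i ->
  peval t e q (qnorm1 i w) = peval t e q w * peval t e (flip t [set i] q) w.
Proof.
move=> qi; rewrite (peval_qsplit w qi).
have fi : flip t [set i] q i * (t - flip t [set i] q i) = e i.
  by rewrite flip_root.
rewrite (peval_qsplit w fi) [flip _ _ _ i]/flip set11.
have occN j : qoccurs j (qsplit i w).1 || qoccurs j (qsplit i w).2 ->
    flip t [set i] q j = q j.
  by move/(implyP (qoccurs_qsplit _ _ _)) => /andP[ji _]; rewrite /flip inE (negPf ji).
rewrite (peval_ext t (q := flip t [set i] q) (q' := q) (w := (qsplit i w).1)
          (fun=> erefl)); last by move=> j oj; rewrite occN ?oj.
rewrite (peval_ext t (q := flip t [set i] q) (q' := q) (w := (qsplit i w).2)
          (fun=> erefl)); last by move=> j oj; rewrite occN ?oj ?orbT.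
rewrite /qnorm1; case: (qsplit i w) => a b /=.
by rewrite -qi; ring.
Qed.

Lemma prod_subsets_cons (R : comNzRingType) (i : I) (S : {set I})
    (F : {set I} -> R) : i \notin S ->
  \prod_(A : {set I} | A \subset i |: S) F A =
  (\prod_(A : {set I} | A \subset S) F A) *
  \prod_(A : {set I} | A \subset S) F (i |: A).
Proof.
move=> iS; rewrite (bigID (fun A : {set I} => i \in A)) /= mulrC; congr (_ * _).
  apply: eq_bigl => A; apply/andP/idP => [[sA iA]|sA].
    apply/subsetP => j jA; move: (subsetP sA j jA); rewrite !inE.
    by case/orP => // /eqP ji; rewrite -ji jA in iA.
  by split; [apply: (subset_trans sA); apply: subsetUr |
             apply: contra iS => /(subsetP sA)].
rewrite (reindex_onto (fun A => i |: A) (fun A => A :\ i)); last first.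
  by move=> A /andP[_ iA]; rewrite setD1K.
apply: eq_bigl => A; rewrite setU11 andbT; apply/andP/idP.
  case=> sA /eqP <-; apply/subsetP => j; rewrite !inE => /andP[ji /predU1P[h|jA]].
    by rewrite h eqxx in ji.
  have := subsetP sA j; rewrite !inE jA orbT => /(_ isT).
  by rewrite (negPf ji).
move=> sA; split; first exact: setUS.
by rewrite setU1K //; apply: contra iS => /(subsetP sA).
Qed.

(** Eliminating q_i multiplies the value by its conjugate under
    q_i -> t - q_i; the conjugations commute, so all sign patterns appear. *)
Lemma peval_qnorm (R : comNzRingType) (t : R) (e q : I -> R) s w :
  uniq s -> (forall i, i \in s -> q i * (t - q i) = e i) ->
  peval t e q (qnorm s w) =
  \prod_(A : {set I} | A \subset [set i in s]) peval t e (flip t A q) w.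
Proof.
elim: s q => [|i s IH] q /=.
  move=> _ _; rewrite (big_pred1 set0).
    by apply: peval_ext => // j _; rewrite /flip inE.
  by move=> A /=; rewrite -subset0; congr (A \subset _); apply/setP=> j; rewrite !inE.
move=> /andP[is_ us] qe.
rewrite peval_qnorm1 ?qe ?mem_head // IH //; last first.
  by move=> j js; rewrite qe // inE js orbT.
rewrite IH //; last first.
  by move=> j js; rewrite flip_root qe // inE js orbT.
rewrite set_cons prod_subsets_cons; last by rewrite inE.
congr (_ * _); apply: eq_bigr => A sA; apply: peval_ext => // j _.
rewrite /flip !inE; case: (j =P i) => [->|//] /=.
by case: ifP => // /(subsetP sA); rewrite inE (negPf is_).
Qed.

(** No eliminated variable occurs in the norm, so it is a polynomial function
    of t and e alone. *)
Lemma peval_qnorm0 (R : comNzRingType) (t : R) (e q q' : I -> R) s w :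
  (forall i, i \notin s -> q i = q' i) ->
  peval t e q (qnorm s w) = peval t e q' (qnorm s w).
Proof. by move=> qq; apply: peval_ext => // j /qoccurs_qnorm /andP[js _]; apply: qq. Qed.

End PolynomialExpressions.

(** * The norm of t - sum q *)

(** A nonzero polynomial has fewer roots than there are integers. *)
Lemma exists_notroot (K : numDomainType) (p : {poly K}) :
  p != 0 -> exists s, ~~ root p s.
Proof.
move=> p0; pose l : seq K := [seq i%:R | i <- iota 0 (size p)].
have ul : uniq l.
  by rewrite map_inj_uniq ?iota_uniq // => i j /eqP; rewrite eqr_nat => /eqP.
have /allPn[s _ ps] : ~~ all (root p) l.
  apply/negP => /(max_poly_roots p0)/(_ ul).
  by rewrite size_map size_iota ltnn.
by exists s.
Qed.

Section NormForm.
Variable I : finType.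

Definition lin_pexp : pexp I :=
  PAdd (PT _) (PMul (PC _ (-1)) (psum [seq PQ i | i <- enum I])).

Definition sumnorm (R : comNzRingType) (t : R) (e : I -> R) : R :=
  peval t e (fun=> 0) (qnorm (enum I) lin_pexp).

Lemma sumnormE (R : comNzRingType) (t : R) (e q : I -> R) :
  (forall i, q i * (t - q i) = e i) ->
  sumnorm t e = \prod_(A : {set I}) (t - \sum_i flip t A q i).
Proof.
move=> qe; rewrite /sumnorm (peval_qnorm0 _ _ (q' := q)); last first.
  by move=> i; rewrite mem_enum.
rewrite peval_qnorm ?enum_uniq //.
rewrite (eq_bigl predT) => [|A]; last first.
  by apply/subsetP => i _; rewrite inE mem_enum.
apply: eq_bigr => A _ /=; rewrite (peval_psum _ _ _ (enum I) (@PQ I)) big_enum /=.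
by rewrite mulN1r.
Qed.

Lemma sumnorm_morph (R S : comNzRingType) (f : {rmorphism R -> S}) t e :
  f (sumnorm t e) = sumnorm (f t) (f \o e).
Proof.
by rewrite /sumnorm peval_morph; apply: peval_ext => // j _ /=; rewrite rmorph0.
Qed.

Lemma eq_sumnorm (R : comNzRingType) (t : R) (e e' : I -> R) :
  e =1 e' -> sumnorm t e = sumnorm t e'.
Proof. by move=> ee; apply: peval_ext. Qed.

Lemma sumnorm_congr (R : comNzRingType) (x t : R) (e e' : I -> R) :
  (forall i, exists y, e i = e' i + x * y) ->
  exists y, sumnorm t e = sumnorm t e' + x * y.
Proof. exact: peval_congr. Qed.

(** As a polynomial in U = 'X with e_i = d_i U and t = 1.  A nonzero root U is a
    value at which the roots of q_i (1 - q_i) = d_i U can be chosen with sum 1. *)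
Definition normpoly (R : comNzRingType) (d : I -> R) : {poly R} :=
  sumnorm 1 (fun i => (d i)%:P * 'X).

Lemma map_normpoly (R S : comNzRingType) (f : {rmorphism R -> S}) d :
  map_poly f (normpoly d) = normpoly (f \o d).
Proof.
rewrite /normpoly sumnorm_morph rmorph1; apply: eq_sumnorm => i /=.
by rewrite rmorphM /= map_polyC map_polyX.
Qed.

Lemma horner_normpoly (R : comNzRingType) (d : I -> R) u :
  (normpoly d).[u] = sumnorm 1 (fun i => d i * u).
Proof.
rewrite -[LHS]/(horner_eval u (normpoly d)) sumnorm_morph rmorph1.
by apply: eq_sumnorm => i /=; rewrite /horner_eval !hornerE.
Qed.

Section Closed.
Variable K : numClosedFieldType.
Implicit Types (d e q : I -> K) (t u : K).

Definition qroot t e : I -> K := fun i => (t + sqrtC (t ^+ 2 - 4 * e i)) / 2.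

Lemma qrootP t e i : qroot t e i * (t - qroot t e i) = e i.
Proof.
rewrite /qroot.
have : sqrtC (t ^+ 2 - 4 * e i) ^+ 2 = t ^+ 2 - 4 * e i by rewrite sqrtCK.
set s := sqrtC _ => sE.
have -> : (t + s) / 2 * (t - (t + s) / 2) = (t ^+ 2 - s ^+ 2) / 4 by field.
by rewrite sE; field.
Qed.

(** The branch through 0 of the root of q (1 - q) = c X as a truncated power
    series, by Hensel lifting: near q = 0 the derivative of q - q^2 is a unit. *)
Lemma series_root (N : nat) (c : K) : exists a r : {poly K},
  a.[0] = c /\ 'X * a * (1 - 'X * a) = c%:P * 'X + 'X^(N.+2) * r.
Proof.
elim: N => [|N [a [r [a0 ar]]]].
  by exists c%:P, (- c%:P ^+ 2); rewrite hornerC; split=> //; ring.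
have [r1 rE] : exists r1, r - (r.[0])%:P = r1 * 'X.
  have /factor_theorem[r1 rE] : root (r - (r.[0])%:P) 0.
    by rewrite /root !hornerE subrr.
  by exists r1; rewrite rE subr0.
set r0 := (r.[0])%:P in rE.
have {}rE : r = r0 + r1 * 'X by rewrite -rE addrC subrK.
exists (a - 'X^(N.+1) * r0), (r1 + 2 * a * r0 - 'X^(N.+1) * r0 ^+ 2).
split; first by rewrite !hornerE a0 expr0n /= mul0r subr0.
have -> : 'X * (a - 'X^(N.+1) * r0) * (1 - 'X * (a - 'X^(N.+1) * r0)) =
   'X * a * (1 - 'X * a) - 'X * 'X^(N.+1) * r0 * (1 - 2 * 'X * a + 'X * 'X^(N.+1) * r0).
  by ring.
rewrite ar rE !exprS; ring.
Qed.

(** The factor of a choice A of the branches near 1 is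
    (1 - #|A|) + U (sum_A d - sum_(~A) d) + O(U^2): the first product collects the
    first order terms for #|A| = 1, the second the values of the other factors. *)
Definition low_coef d : K :=
  (\prod_j (d j - \sum_(i | i != j) d i)) *
  \prod_(A : {set I} | #|A| != 1%N) (1 - #|A|%:R).

(** At U = 0 only the n choices with one root equal to 1 have sum 1, and their
    factors vanish to first order. *)
Lemma normpoly_low d : exists y : {poly K},
  normpoly d = 'X^#|I| * y /\ y.[0] = low_coef d.
Proof.
have /fin_all_exists2[a a0 /fin_all_exists[r ar]] : forall i, exists2 a : {poly K},
    a.[0] = d i & exists r : {poly K},
    'X * a * (1 - 'X * a) = (d i)%:P * 'X + 'X^(#|I|.+2) * r.
  by move=> i; have [a [r [? ?]]] := series_root #|I| (d i); exists a => //; exists r.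
have [z zE] : exists z, sumnorm 1 (fun i => 'X * a i * (1 - 'X * a i)) =
    normpoly d + 'X^(#|I|.+2) * z.
  by apply: sumnorm_congr => i; exists (r i).
pose x (A : {set I}) := \sum_i (if i \in A then a i else - a i).
have xE A : 1 - \sum_i flip 1 A (fun i => 'X * a i) i =
    (1 - #|A|%:R) + 'X * x A.
  have -> : #|A|%:R = \sum_i (i \in A)%:R :> {poly K}.
    by rewrite -sum1_card natr_sum big_mkcond; apply: eq_bigr => i _; case: ifP.
  rewrite /x mulr_sumr -addrA -sumrN -sumrN -big_split /=; congr (_ + _).
  apply: eq_bigr => i _; rewrite /flip.
  by case: ifP => _ /=; ring.
have x0 A : (x A).[0] = \sum_i (if i \in A then d i else - d i).
  rewrite /x horner_sum; apply: eq_bigr => i _; case: ifP; rewrite ?hornerE a0 //.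
rewrite (sumnormE (q := fun i => 'X * a i)) in zE; last by [].
rewrite (eq_bigr _ (fun A _ => xE A)) in zE.
rewrite (bigID (fun A : {set I} => #|A| == 1%N)) /= in zE.
rewrite [X in X * _](eq_bigl (fun A => A \in [set [set j] | j : I])) in zE; last first.
  move=> A; apply/cards1P/imsetP => [[j ->]|[j _ ->]]; by exists j.
rewrite big_imset /= in zE; last by move=> i j _ _; apply: set1_inj.
rewrite (eq_bigr (fun j => 'X * x [set j])) in zE; last first.
  by move=> j _; rewrite cards1 subrr add0r.
rewrite big_split /= prodr_const in zE.
exists ((\prod_i x [set i]) * \prod_(A : {set I} | #|A| != 1%N) (1 - #|A|%:R + 'X * x A)
   - 'X ^+ 2 * z).
split.
  have -> : normpoly d = normpoly d + 'X^(#|I|.+2) * z - 'X^(#|I|.+2) * z by rewrite addrK.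
  by rewrite -zE -addn2 exprD cardT -cardE; ring.
rewrite !hornerE expr0n /= mul0r subr0 /low_coef !horner_prod.
congr (_ * _); apply: eq_bigr => A _.
  rewrite x0 (bigD1 A) //= set11 -sumrN; congr (_ + _); apply: eq_bigr => i iA.
  by rewrite inE (negPf iA).
by rewrite !hornerE -polyC_natr hornerC.
Qed.

Lemma card_subsets : #|{set I}| = (2 ^ #|I|)%N.
Proof. by rewrite -[in RHS](cardsT I) -card_powerset powersetT cardsT. Qed.

(** Homogeneity: multiplying all roots by a constant scales t by it and e by
    its square. *)
Lemma sumnorm_scale t d : t != 0 ->
  sumnorm t d = t ^+ (2 ^ #|I|) * sumnorm 1 (fun i => d i * t^-1 ^+ 2).
Proof.
move=> t0; pose q := qroot t d.
rewrite (sumnormE (q := q)); last by move=> i; apply: qrootP.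
rewrite (sumnormE (q := fun i => q i / t)); last first.
  by move=> i; rewrite -(qrootP t d i) -/q; field.
rewrite -card_subsets -prodr_const -big_split /=; apply: eq_bigr => A _.
rewrite mulrBr mulr1 mulr_sumr; congr (_ - _); apply: eq_bigr => i _.
by rewrite /flip; case: ifP => _; field.
Qed.

Lemma poly_eq_nonzero (p q : {poly K}) :
  (forall s, s != 0 -> p.[s] = q.[s]) -> p = q.
Proof.
move=> pq; apply/eqP; rewrite -subr_eq0; apply/negPn/negP => nz.
have [s] := exists_notroot (mulf_neq0 nz (negbT (polyX_eq0 K))).
rewrite rootM rootX negb_or rootE => /andP[+ s0].
by rewrite hornerD hornerN pq // subrr eqxx.
Qed.

(** By homogeneity S^(2^n) g(1/S^2) is the norm with t = S and e = d, which is
    again a polynomial in S; comparing coefficients bounds the degree of g, and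
    its constant term, the norm with t = 0, is the coefficient of U^(2^(n-1)). *)
Lemma normpoly_top d : (0 < #|I|)%N ->
  (size (normpoly d) <= (2 ^ (#|I|.-1)).+1)%N /\
  (normpoly d)`_(2 ^ (#|I|.-1)) = sumnorm 0 d.
Proof.
move=> n0; set m := (2 ^ #|I|.-1)%N; set g := normpoly d.
have m2 : (2 ^ #|I| = 2 * m)%N by rewrite /m -expnS prednK.
pose phi : {poly K} := sumnorm 'X (fun i => (d i)%:P).
have phiE s : phi.[s] = sumnorm s d.
  rewrite -[LHS]/(horner_eval s phi) sumnorm_morph /= /horner_eval hornerX.
  by apply: eq_sumnorm => i /=; rewrite hornerC.
pose N := size g.
have E : phi * 'X^(2 * N) = \sum_(i < N) g`_i *: 'X^(2 * m + 2 * (N - i)).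
  apply: poly_eq_nonzero => s s0.
  rewrite hornerM hornerXn phiE sumnorm_scale // -horner_normpoly -/g horner_coef.
  rewrite horner_sum mulrAC mulr_sumr; apply: eq_bigr => i _.
  have iN : (i <= N)%N by rewrite ltnW.
  have -> : s ^+ (2 * N) = s ^+ (2 * (N - i)) * (s ^+ 2) ^+ i.
    by rewrite -exprM -exprD -mulnDr subnK.
  rewrite hornerZ hornerXn m2 exprD exprVn.
  have : (s ^+ 2) ^+ i * (s ^- 2) ^+ i = 1.
    by rewrite exprVn divff // !expf_neq0.
  move: (s ^- 2 ^+ i) (s ^+ 2 ^+ i) => x y xy.
  by rewrite -[RHS]mulr1 -xy; ring.
have coE i : (i < N)%N -> g`_i = (phi * 'X^(2 * N))`_(2 * m + 2 * (N - i)).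
  move=> iN; rewrite E coef_sum (bigD1 (Ordinal iN)) //= coefZ coefXn eqxx mulr1.
  rewrite big1 ?addr0 // => j jN; rewrite coefZ coefXn.
  case: eqP => [h|_]; last by rewrite mulr0.
  case/eqP: jN; apply/val_inj => /=; have := ltn_ord j; lia.
have phi0 : phi`_0 = sumnorm 0 d by rewrite -horner_coef0 phiE.
split.
  apply/leq_sizeP => i mi; case: (ltnP i N) => iN; last exact: nth_default.
  by rewrite coE // coefMXn ifT //; lia.
rewrite -phi0; case: (ltnP m N) => mN.
  rewrite coE // coefMXn ifF; last by lia.
  by congr (_`_ _); lia.
rewrite nth_default //.
have : (phi * 'X^(2 * N))`_(2 * N) = 0.
  rewrite E coef_sum big1 // => i _; rewrite coefZ coefXn.
  by case: eqP => [|_]; [have := ltn_ord i; lia | rewrite mulr0].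
by rewrite coefMXn ltnn subnn.
Qed.

End Closed.
End NormForm.

(** * Separability and derivatives *)

(** The Sylvester matrix commutes with a morphism that keeps the degrees. *)
Lemma resultant_map (R S : nzRingType) (f : {rmorphism R -> S})
    (p q : {poly R}) :
  f (lead_coef p) != 0 -> f (lead_coef q) != 0 ->
  f (resultant p q) = resultant (map_poly f p) (map_poly f q).
Proof.
move=> fp fq; rewrite /resultant /Sylvester_mx !size_map_poly_id0 // -det_map_mx.
rewrite map_col_mx; congr (\det (col_mx _ _)); apply: map_lin1_mx => v;
  by rewrite map_poly_rV rmorphM /= map_rVpoly.
Qed.

(** Keeping the degree and having a nonzero resultant with the derivative are
    both polynomial conditions on v, and v0 satisfies them. *)
Lemma generic_separable (K : numFieldType) (m N : nat)
    (k : {poly {mpoly K[m]}}) (v0 : 'I_m -> K) :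
  (0 < N)%N -> (size k <= N.+1)%N ->
  size (map_poly (meval v0) k) = N.+1 ->
  separable_poly (map_poly (meval v0) k) ->
  exists f : {mpoly K[m]}, f.@[v0] != 0 /\
    forall v, f.@[v] != 0 -> size (map_poly (meval v) k) = N.+1 /\
                             separable_poly (map_poly (meval v) k).
Proof.
move=> N0 kN sz0 sep0.
have szk : size k = N.+1.
  by apply/eqP; rewrite eqn_leq kN -sz0 size_poly.
have leadk : lead_coef k = k`_N by rewrite lead_coefE szk.
have evk v : (k`_N).@[v] = (map_poly (meval v) k)`_N by rewrite coef_map.
have kN0 : (k`_N).@[v0] != 0.
  by rewrite evk -[N in _`_N]/N.+1.-1 -sz0 -lead_coefE lead_coef_eq0 -size_poly_eq0 sz0.
have szk' : size k^`() = N.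
  apply/eqP; rewrite eqn_leq; apply/andP; split.
    by rewrite -ltnS -szk lt_size_deriv // -size_poly_eq0 szk.
  rewrite -(prednK N0) ltnNge; apply/negP => /leq_sizeP/(_ _ (leqnn _)).
  rewrite coef_deriv prednK // => /(congr1 (meval v0)); rewrite mevalMn meval0.
  by move/eqP; rewrite mulrn_eq0 (gtn_eqF N0) (negPf kN0).
have leadk' : lead_coef k^`() = k`_N *+ N.
  by rewrite lead_coefE szk' coef_deriv prednK.
have res v : (k`_N).@[v] != 0 -> (resultant k k^`()).@[v] =
    resultant (map_poly (meval v) k) (map_poly (meval v) k)^`().
  move=> kv; rewrite (resultant_map (f := meval v)) ?deriv_map //.
    by rewrite leadk.
  by rewrite leadk' raddfMn mulrn_eq0 (gtn_eqF N0).
have sepE (p : {poly K}) : p != 0 -> separable_poly p = (resultant p p^`() != 0).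
  move=> p0; rewrite resultant_eq0 unlock coprimep_def -leqNgt eqn_leq.
  by rewrite [(1 <= _)%N]lt0n size_poly_eq0 gcdp_eq0 (negPf p0) andbT.
have nz v : (k`_N).@[v] != 0 -> map_poly (meval v) k != 0.
  by apply: contraNneq => k0; rewrite evk k0 coef0.
exists (k`_N * resultant k k^`()); split.
  by rewrite mevalM mulf_neq0 // res // -sepE // nz.
move=> v; rewrite mevalM mulf_eq0 negb_or => /andP[kv rv].
split; last by rewrite sepE ?nz // -res.
by rewrite -szk size_map_poly_id0 // leadk.
Qed.

Lemma separable_roots (K : closedFieldType) (p : {poly K}) :
  separable_poly p ->
  exists rs : seq K, [/\ uniq rs, size rs = (size p).-1 & forall x, root p x = (x \in rs)].
Proof.
move=> sp; have p0 := separable_poly_neq0 sp.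
have [rs pE] := closed_field_poly_normal p; exists rs.
have l0 : lead_coef p != 0 by rewrite lead_coef_eq0.
split.
- rewrite -separable_prod_XsubC; move: sp; rewrite {1}pE.
  by rewrite (eqp_separable (eqp_scale _ l0)).
- by rewrite pE size_scale // size_prod_XsubC.
- by move=> x; rewrite pE rootZ // root_prod_XsubC.
Qed.

(** Lift the roots q_i to first order at u: q_i + q_i' (X - u) with
    q_i' = d_i / (1 - 2 q_i).  Modulo (X - u)^2 the polynomial is the product over
    all choices of the lifted factors, and the factor of the choice q itself is
    - (sum q') (X - u).  So the root u is simple only if no other choice of roots
    has sum 1. *)
Lemma normpoly_deriv (K : fieldType) (I : finType) (d q : I -> K) (u : K) :
  (forall i, q i * (1 - q i) = d i * u) -> (forall i, 1 - 2 * q i != 0) ->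
  \sum_i q i = 1 ->
  (normpoly d)^`().[u] = - (\sum_i d i / (1 - 2 * q i)) *
    \prod_(A : {set I} | A != set0) (1 - \sum_i flip 1 A q i).
Proof.
move=> qd q2 q1; pose q' i := d i / (1 - 2 * q i).
pose s i : {poly K} := (q i)%:P + (q' i)%:P * ('X - u%:P).
have [z zE] : exists z, sumnorm 1 (fun i => s i * (1 - s i)) =
    normpoly d + ('X - u%:P) ^+ 2 * z.
  apply: sumnorm_congr => i; exists (- (q' i)%:P ^+ 2).
  have dE : (d i)%:P = (q' i)%:P * (1 - 2 * (q i)%:P).
    by rewrite -polyC1 -polyC_natr -polyCM -polyCB -polyCM; congr _%:P;
      rewrite /q' divfK.
  have duE : (d i)%:P * u%:P = (q i)%:P * (1 - (q i)%:P).
    by rewrite -polyC1 -polyCM -polyCB -polyCM qd.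
  transitivity ((d i)%:P * u%:P + (q' i)%:P * (1 - 2 * (q i)%:P) * ('X - u%:P)
     - ((q' i)%:P * ('X - u%:P)) ^+ 2); first by rewrite duE /s; ring.
  by rewrite -dE; ring.
rewrite (sumnormE (q := s)) // (bigD1 set0) //= in zE.
have -> : normpoly d = normpoly d + ('X - u%:P) ^+ 2 * z - ('X - u%:P) ^+ 2 * z.
  by rewrite addrK.
rewrite -zE.
have -> : 1 - \sum_i flip 1 set0 s i = (- \sum_i q' i)%:P * ('X - u%:P).
  rewrite (eq_bigr s) => [|i _]; last by rewrite /flip inE.
  rewrite /s big_split /= -mulr_suml -rmorph_sum q1 -rmorph_sum /=.
  by rewrite polyCN mulNr opprD addNKr.
set F := \prod_(_ | _) _; set Y := 'X - u%:P; set c := - _.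
have -> : (c%:P * Y * F - Y ^+ 2 * z)^`() =
    c%:P * Y^`() * F + Y * (c%:P * F^`() - (2 * Y^`() * z + Y * z^`())).
  by rewrite derivB expr2 !derivM derivC; ring.
have Y0 : Y.[u] = 0 by rewrite hornerXsubC subrr.
rewrite hornerD !hornerM Y0 mul0r addr0 derivXsubC !hornerC mulr1.
congr (_ * _); rewrite horner_prod; apply: eq_bigr => A _.
rewrite hornerD hornerN hornerC horner_sum; congr (_ - _); apply: eq_bigr => i _.
have sE : (s i).[u] = q i by rewrite hornerD hornerM -/Y Y0 !hornerC mulr0 addr0.
by rewrite /flip; case: ifP => _; last exact: sE; rewrite hornerD hornerN hornerC sE.
Qed.

(** * Regular vertex sums *)

Lemma top_coefM (R : nzRingType) (p q : {poly R}) a b :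
  (size p <= a.+1)%N -> (size q <= b.+1)%N ->
  (size (p * q)%R <= (a + b).+1)%N /\ (p * q)`_(a + b) = p`_a * q`_b.
Proof.
move=> pa qb; split.
  by apply: leq_trans (size_polyMleq _ _) _; lia.
have ab : (a < (a + b).+1)%N by lia.
rewrite coefM (bigD1 (Ordinal ab)) //= addKn big1 ?addr0 // => i ia.
have ia' : nat_of_ord i != a by apply: contraNneq ia => h; apply/eqP/val_inj.
case: (ltnP i a) => h.
  by rewrite [q`__]nth_default ?mulr0 //; apply: leq_trans qb _; have := ltn_ord i; lia.
by rewrite [p`__]nth_default ?mul0r //; apply: leq_trans pa _; lia.
Qed.

Lemma top_coef_prod (R : nzRingType) (J : Type) (s : seq J) (F : J -> {poly R}) :
  (forall j, size (F j) <= 2)%N ->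
  (size (\prod_(j <- s) F j)%R <= (size s).+1)%N /\
  (\prod_(j <- s) F j)`_(size s) = \prod_(j <- s) (F j)`_1.
Proof.
move=> F2; elim: s => [|j s [IHs IHc]].
  by rewrite !big_nil size_poly1 coef1.
by rewrite !big_cons /= -IHc; apply: (top_coefM (F2 j) IHs).
Qed.

Lemma coprimep_noroot (K : closedFieldType) (p q : {poly K}) :
  p != 0 -> (forall x, root p x -> ~~ root q x) -> coprimep p q.
Proof.
move=> p0 pq; rewrite /coprimep; apply/negPn/negP => /closed_rootP[x].
by rewrite root_gcd => /andP[/pq/negP].
Qed.

Lemma exists_notin (K : numDomainType) (s : seq K) : exists y, y \notin s.
Proof.
have [y] := exists_notroot (monic_neq0 (monic_prod_XsubC s predT id)).
by rewrite root_prod_XsubC; exists y.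
Qed.

Section Discriminant.
Variable I : finType.
Local Notation n := #|I|.
Hypothesis n_gt2 : (2 < n)%N.

(** The normalized volume of the second hypersimplex, which is the degree of
    the toric variety of the model. *)
Definition hypersimplex_degree : nat := (2 ^ (n - 1) - n)%N.

(** The polynomial [normpoly] divided by U^n.  Fixed bounds on the indices make
    its coefficients polynomial in those of [normpoly]. *)
Definition rootpoly (R : comNzRingType) (d : I -> R) : {poly R} :=
  \poly_(i < hypersimplex_degree.+1) (normpoly d)`_(i + n).

(** The factors other than [rootpoly] are there so that separability of the
    product says more: no root is 0, and at a root no quadratic
    q (1 - q) = d_i U is degenerate, as its discriminant is 1 - 4 d_i U. *)
Definition regpoly (R : comNzRingType) (d : I -> R) : {poly R} :=
  'X * rootpoly d * \prod_(i <- enum I) (1 - (4 * d i)%:P * 'X).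

Lemma map_regpoly (R S : comNzRingType) (f : {rmorphism R -> S}) d :
  map_poly f (regpoly d) = regpoly (f \o d).
Proof.
rewrite /regpoly !rmorphM /= map_polyX rmorph_prod; congr (_ * _ * _).
  apply/polyP => i; rewrite coef_map !coef_poly /=.
  by case: ifP; rewrite ?rmorph0 // -map_normpoly coef_map.
apply: eq_bigr => i _; rewrite rmorphB rmorph1 rmorphM /= map_polyC map_polyX.
by rewrite /= rmorphM rmorph_nat.
Qed.

Lemma regpoly_top (R : comNzRingType) (d : I -> R) :
  (size (regpoly d) <= (1 + hypersimplex_degree + n).+1)%N /\
  (regpoly d)`_(1 + hypersimplex_degree + n) =
    (rootpoly d)`_hypersimplex_degree * \prod_i (- (4 * d i)).
Proof.
have sl i : (size (1 - (4 * d i)%:P * 'X : {poly R})%R <= 2)%N.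
  apply/leq_sizeP => j j1; rewrite coefB coef1 coefMX coefC.
  by case: j j1 => [|[|j]] //= _; rewrite subrr.
have [sP cP] := top_coef_prod (enum I) sl.
have [sh ch] : (size ('X * rootpoly d : {poly R})%R <= (1 + hypersimplex_degree).+1)%N /\
    ('X * rootpoly d)`_(1 + hypersimplex_degree) = (rootpoly d)`_hypersimplex_degree.
  have -> : (rootpoly d)`_hypersimplex_degree =
      ('X : {poly R})`_1 * (rootpoly d)`_hypersimplex_degree.
    by rewrite coefX mul1r.
  by apply: top_coefM; rewrite ?size_polyX // size_poly.
rewrite -cardE in sP cP.
have [sk ck] := top_coefM sh sP; split=> //.
rewrite ck ch cP big_enum; congr (_ * _); apply: eq_bigr => i _.
by rewrite coefB coef1 coefMX coefC sub0r.
Qed.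

Section Closed.
Variable K : numClosedFieldType.
Implicit Types d q : I -> K.

Lemma leq_n_exp : (n <= 2 ^ (n - 1))%N.
Proof.
have : (0 < n)%N by lia.
by case: n => // m _; rewrite subSS subn0; elim: m => // m IH; rewrite expnS; lia.
Qed.

Lemma normpoly_rootpoly d : normpoly d = 'X^n * rootpoly d.
Proof.
have n0 : (0 < n)%N by lia.
have [y [gy _]] := normpoly_low d; rewrite gy; congr (_ * _).
have [sg _] := normpoly_top d n0; rewrite -subn1 in sg.
apply/polyP => i; rewrite coef_poly.
have yi : (normpoly d)`_(i + n) = y`_i by rewrite gy coefXnM ltnNge leq_addl /= addnK.
case: ifP => h; rewrite -yi //; apply: nth_default; apply: leq_trans sg _.
by move: h; rewrite /hypersimplex_degree; have := leq_n_exp; lia.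
Qed.

Lemma rootpoly0 d : (rootpoly d).[0] = low_coef d.
Proof.
have [y [gy <-]] := normpoly_low d; move: gy; rewrite normpoly_rootpoly.
by move/(mulfI (monic_neq0 (monicXn _ _))) ->.
Qed.

Lemma rootpoly_top d : (rootpoly d)`_hypersimplex_degree = sumnorm 0 d.
Proof.
have n0 : (0 < n)%N by lia.
have [_ <-] := normpoly_top d n0.
rewrite coef_poly ltnSn -subn1; congr (_`_ _).
by rewrite /hypersimplex_degree; have := leq_n_exp; lia.
Qed.

Definition regular_degrees d : Prop :=
  size (regpoly d) = (1 + hypersimplex_degree + n).+1 /\ separable_poly (regpoly d).

Lemma root_rootpoly d u : u != 0 -> root (rootpoly d) u = root (normpoly d) u.
Proof.
move=> u0; rewrite normpoly_rootpoly rootM [X in _ = X || _]rootE hornerXn.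
by rewrite expf_eq0 (negPf u0) andbF.
Qed.

Lemma root_normpolyP d u :
  root (normpoly d) u <->
  exists q, (forall i, q i * (1 - q i) = d i * u) /\ \sum_i q i = 1.
Proof.
rewrite rootE horner_normpoly; split.
  rewrite (sumnormE (q := qroot 1 (fun i => d i * u))); last by move=> i; apply: qrootP.
  case/prodf_eq0 => A _ /eqP/subr0_eq h.
  exists (flip 1 A (qroot 1 (fun i => d i * u))); split; last by rewrite -h.
  by move=> i /=; rewrite flip_root qrootP.
move=> [q [qd q1]]; rewrite (sumnormE (q := q)) //; apply/prodf_eq0; exists set0 => //.
rewrite -q1 subr_eq0; apply/eqP; apply: eq_bigr => i _; by rewrite /flip inE.
Qed.

Lemma flip_setE d u q q' :
  (forall i, q i * (1 - q i) = d i * u) -> (forall i, q' i * (1 - q' i) = d i * u) ->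
  q' =1 flip 1 [set i | q' i != q i] q.
Proof.
move=> qd q'd i; rewrite /flip inE; case: eqP => //= ne.
have : (q' i - q i) * (q' i - (1 - q i)) = 0.
  have -> : (q' i - q i) * (q' i - (1 - q i)) = q i * (1 - q i) - q' i * (1 - q' i) by ring.
  by rewrite qd q'd subrr.
by move/eqP; rewrite mulf_eq0 subr_eq0 => /orP[/eqP//|/eqP/subr0_eq].
Qed.

Lemma disc_sqr (q c u : K) : q * (1 - q) = c * u -> (1 - 2 * q) ^+ 2 = 1 - 4 * c * u.
Proof. by move=> h; rewrite -mulrA -h; ring. Qed.

Lemma disc_eq0 (q c u : K) : q * (1 - q) = c * u ->
  (1 - 2 * q == 0) = (1 - 4 * c * u == 0).
Proof. by move=> /disc_sqr <-; rewrite expf_eq0. Qed.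

Lemma low_coef_neq0 d : low_coef d != 0 <-> forall j, d j != \sum_(i | i != j) d i.
Proof.
have c0 : \prod_(A : {set I} | #|A| != 1%N) (1 - #|A|%:R) != 0 :> K.
  by apply/prodf_neq0 => A A1; rewrite subr_eq0 eq_sym pnatr_eq1.
rewrite /low_coef mulf_eq0 negb_or c0 andbT; split.
  by move/prodf_neq0 => h j; have := h j isT; rewrite subr_eq0.
by move=> h; apply/prodf_neq0 => j _; rewrite subr_eq0.
Qed.

(** What regularity of d means for the counting problem.  The four parts come
    from the leading coefficient, the constant coefficient of [rootpoly], the
    leading coefficient of [rootpoly], and the simplicity of the roots, which by
    [normpoly_deriv] makes the choice of q unique. *)
Lemma regular_degreesP d : regular_degrees d ->
  [/\ forall j, d j != 0, forall j, d j != \sum_(i | i != j) d i,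
      forall th : I -> K, (forall i, th i ^+ 2 = - d i) -> \sum_i th i != 0
    & exists rs : seq K, [/\ uniq rs, size rs = hypersimplex_degree,
        forall u, u \in rs -> u != 0 /\ exists q,
          [/\ forall i, q i * (1 - q i) = d i * u, \sum_i q i = 1 &
              forall q', (forall i, q' i * (1 - q' i) = d i * u) ->
                \sum_i q' i = 1 -> q' =1 q]
      & forall u q, u != 0 -> (forall i, q i * (1 - q i) = d i * u) ->
          \sum_i q i = 1 -> u \in rs]].
Proof.
move=> [sk sepk].
have : (regpoly d)`_(1 + hypersimplex_degree + n) != 0.
  rewrite -[(1 + _ + _)%N]/(1 + hypersimplex_degree + n).+1.-1 -sk -lead_coefE.
  by rewrite lead_coef_eq0 -size_poly_eq0 sk.
rewrite (regpoly_top d).2 mulf_eq0 negb_or => /andP[hD /prodf_neq0 dn].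
have d0 j : d j != 0.
  by have := dn j isT; rewrite oppr_eq0 mulf_eq0 negb_or => /andP[].
move: sepk; rewrite /regpoly !separable_mul => /and3P[/and3P[_ seph cop0] _ cop4].
have h0 : ~~ root (rootpoly d) 0.
  by move: cop0; rewrite -['X]subr0 -polyC0 coprimep_sym coprimep_XsubC.
have h4 u i : root (rootpoly d) u -> 1 - 4 * d i * u != 0.
  move=> hu; move: cop4; rewrite coprimepMl => /andP[_ /coprimep_root/(_ hu)].
  rewrite big_enum horner_prod => /prodf_neq0/(_ i isT).
  by rewrite hornerD hornerN hornerM hornerX !hornerC.
have hsz : size (rootpoly d) = hypersimplex_degree.+1.
  apply/eqP; rewrite eqn_leq size_poly /= ltnNge; apply/negP => h.
  by rewrite nth_default ?eqxx in hD.
have rE u q : u != 0 -> (forall i, q i * (1 - q i) = d i * u) -> \sum_i q i = 1 ->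
    root (rootpoly d) u.
  by move=> u0 qd q1; rewrite root_rootpoly //; apply/root_normpolyP; exists q.
split=> //.
- by apply/low_coef_neq0; rewrite -rootpoly0.
- move=> th thd; move: hD; rewrite rootpoly_top; apply: contraNneq => th0.
  rewrite (sumnormE (q := th)); last by move=> i; rewrite sub0r mulrN -expr2 thd opprK.
  rewrite (bigD1 set0) //= (eq_bigr th) => [|i _]; last by rewrite /flip inE.
  by rewrite th0 subrr mul0r.
have [rs [urs srs rsE]] := separable_roots seph; exists rs; split=> //.
- by rewrite srs hsz.
- move=> u; rewrite -rsE => hu.
  have u0 : u != 0 by apply: contraNneq h0 => <-.
  split=> //; have /root_normpolyP[q [qd q1]] : root (normpoly d) u by rewrite -root_rootpoly.
  exists q; split=> // q' q'd q'1.
  have g' : (normpoly d)^`().[u] != 0.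
    rewrite normpoly_rootpoly derivM hornerD !hornerM (rootP hu) mulr0 add0r.
    rewrite mulf_neq0 ?hornerXn ?expf_neq0 //.
    by move: seph; rewrite unlock => /coprimep_root/(_ hu).
  rewrite (normpoly_deriv qd _ q1) in g'; last first.
    by move=> i; rewrite (disc_eq0 (qd i)) h4.
  move: g'; rewrite mulf_eq0 negb_or => /andP[_ /prodf_neq0 g'].
  set A := [set i | q' i != q i].
  have [A0|A0] := eqVneq A set0.
    move=> i; apply/eqP; have := in_set0 i; rewrite -A0 inE.
    by move/negbFE.
  have := g' A A0; rewrite subr_eq0 -{1}q'1 => /eqP; case.
  by apply: eq_bigr => i _; rewrite -(flip_setE qd q'd).
- by move=> u q u0 qd q1; rewrite -rsE; apply: (rE u q).
Qed.

(** The converse criterion used for the example: a root is simple when its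
    choice q is unique, no q_i is a double root, and the lifted sum moves to
    first order. *)
Lemma regular_degreesI d :
  (forall j, d j != 0) -> injective d -> (forall j, d j != \sum_(i | i != j) d i) ->
  sumnorm 0 d != 0 ->
  (forall u q, u != 0 -> (forall i, q i * (1 - q i) = d i * u) -> \sum_i q i = 1 ->
     [/\ forall i, 1 - 2 * q i != 0,
         forall A : {set I}, A != set0 -> \sum_i flip 1 A q i != 1
       & \sum_i d i / (1 - 2 * q i) != 0]) ->
  regular_degrees d.
Proof.
move=> d0 injd dj th0 H.
have hD : (rootpoly d)`_hypersimplex_degree != 0 by rewrite rootpoly_top.
have h0 : ~~ root (rootpoly d) 0 by rewrite rootE rootpoly0; apply/low_coef_neq0.
have hn0 : rootpoly d != 0 by apply: contraNneq hD => ->; rewrite coef0.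
split.
  have [sk ck] := regpoly_top d; apply/eqP; rewrite eqn_leq sk ltnNge /=.
  apply/negP => h; move/eqP: ck; rewrite nth_default // eq_sym mulf_eq0 (negPf hD) /=.
  case/prodf_eq0 => i _; rewrite oppr_eq0 mulf_eq0 (negPf (d0 i)) orbF.
  by rewrite pnatr_eq0.
have Hu u : root (rootpoly d) u -> u != 0 by move=> hu; apply: contraNneq h0 => <-.
have linE i : 1 - (4 * d i)%:P * 'X = (- (4 * d i)) *: ('X - ((4 * d i)^-1)%:P).
  rewrite -mul_polyC mulrBr -polyCM mulNr mulfV ?mulf_neq0 ?pnatr_eq0 //.
  by rewrite !polyCN opprK mulNr addrC.
have PE : \prod_(i <- enum I) (1 - (4 * d i)%:P * 'X) %=
    \prod_(x <- [seq (4 * d i)^-1 | i <- enum I]) ('X - x%:P).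
  rewrite (eq_bigr _ (fun i _ => linE i)) big_map.
  rewrite scaler_prod; apply: eqp_scale; rewrite big_enum; apply/prodf_neq0 => i _.
  by rewrite oppr_eq0 mulf_neq0 ?pnatr_eq0.
rewrite /regpoly !separable_mul; apply/and3P; split; first (apply/and3P; split).
- by rewrite -['X]subr0 -polyC0 -[_ - _]mul1r separable_root unlock /= coprime1p root1.
- rewrite unlock; apply: coprimep_noroot => // u hu; rewrite rootE.
  have u0 := Hu u hu.
  have /root_normpolyP[q [qd q1]] : root (normpoly d) u by rewrite -root_rootpoly.
  have [q2 qA qs] := H u q u0 qd q1.
  have : (normpoly d)^`().[u] != 0.
    rewrite (normpoly_deriv qd q2 q1) mulf_neq0 ?oppr_eq0 //.
    by apply/prodf_neq0 => A A0; rewrite subr_eq0 eq_sym qA.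
  rewrite normpoly_rootpoly derivM hornerD !hornerM (rootP hu) mulr0 add0r.
  by rewrite mulf_eq0 negb_or => /andP[].
- by rewrite -['X]subr0 -polyC0 coprimep_sym coprimep_XsubC.
- rewrite (eqp_separable PE) separable_prod_XsubC map_inj_uniq ?enum_uniq //.
  move=> i j /invr_inj /mulfI h; apply: injd; apply: h.
  by rewrite pnatr_eq0.
rewrite (eqp_coprimepr _ PE); apply: coprimep_noroot.
  by rewrite mulf_neq0 ?polyX_eq0.
move=> u; rewrite root_prod_XsubC rootM => hu; apply/negP => /mapP[i _ uE].
have u0 : u != 0 by rewrite uE invr_eq0 mulf_neq0 ?pnatr_eq0.
move: hu; rewrite rootX (negPf u0) /= => hu.
have /root_normpolyP[q [qd q1]] : root (normpoly d) u by rewrite -root_rootpoly.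
have [q2 _ _] := H u q u0 qd q1.
have := q2 i; rewrite (disc_eq0 (qd i)) uE mulfV ?subrr ?eqxx //.
by rewrite mulf_neq0 ?pnatr_eq0.
Qed.

End Closed.
End Discriminant.

(** * Existence of regular vertex sums *)

Section Existence.
Variables (I : finType) (K : numClosedFieldType).
Local Notation n := #|I|.
Hypothesis n_gt2 : (2 < n)%N.
Variable o : I.

Let n_gt0 : (0 < n)%N. Proof. exact: ltnW (ltnW n_gt2). Qed.

(** The last root is determined by the others and the condition sum q = 1. *)
Definition qlast : pexp I :=
  PAdd (PC _ 1) (PMul (PC _ (-1)) (psum [seq PQ i | i <- enum I & i != o])).
Definition rho_pexp (i : I) : pexp I :=
  PAdd (PC _ 1) (PMul (PC _ (-2)) (if i == o then qlast else PQ i)).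
(** In terms of rho = 1 - 2 q, the first factor is the product of all rho times
    sum 1/rho - (n - 2), whose vanishing says that the derivative of sum q is 0
    (see [crit_degrees]); the second one vanishes when changing the roots at some
    nonempty A keeps the sum. *)
Definition crit_pexp : pexp I :=
  PMul (PAdd (psum [seq pprod [seq rho_pexp w | w <- enum [pred w | w != i]]
                       | i <- enum I])
             (PMul (PC _ (- (n - 2)%:Z)) (pprod [seq rho_pexp w | w <- enum I])))
       (pprod [seq psum [seq rho_pexp i | i <- enum A]
                 | A : {set I} <- enum [pred A : {set I} | A != set0]]).

Definition qfull (q : I -> K) : I -> K :=
  fun i => if i == o then 1 - \sum_(j | j != o) q j else q i.
Definition rho (q : I -> K) : I -> K := fun i => 1 - 2 * qfull q i.

Lemma peval_crit (e q : I -> K) : peval 1 e q crit_pexp =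
  (\sum_i \prod_(w | w != i) rho q w - (n - 2)%:R * \prod_w rho q w) *
  \prod_(A : {set I} | A != set0) \sum_(i in A) rho q i.
Proof.
have evr i : peval 1 e q (rho_pexp i) = rho q i.
  rewrite /rho /qfull /=; case: eqP => _ /=; last by rewrite mulNr.
  by rewrite (peval_psum _ _ _ _ (@PQ I)) /= big_filter big_enum_cond /= mulN1r mulNr.
rewrite /=; congr ((_ + _) * _).
- rewrite peval_psum big_enum; apply: eq_bigr => i _.
  by rewrite peval_pprod big_enum; apply: eq_bigr => w _.
- rewrite peval_pprod big_enum mulrNz mulNr; congr (- (_ * _)).
  by apply: eq_bigr => w _.
- rewrite peval_pprod big_enum; apply: eq_bigr => A _.
  by rewrite peval_psum big_enum; apply: eq_bigr => w _.
Qed.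

Lemma crit_ext (e e' q q' : I -> K) : (forall i, i != o -> q i = q' i) ->
  peval 1 e q crit_pexp = peval 1 e' q' crit_pexp.
Proof.
move=> qq; have r i : rho q i = rho q' i.
  rewrite /rho /qfull; case: (eqVneq i o) => [_|/qq -> //].
  by rewrite (eq_bigr q').
rewrite !peval_crit; congr ((_ - _ * _) * _).
- by apply: eq_bigr => i _; apply: eq_bigr.
- exact: eq_bigr.
- by apply: eq_bigr => A _; apply: eq_bigr.
Qed.

Lemma sum_prod_others (r : I -> K) : (forall i, r i != 0) ->
  \sum_i \prod_(w | w != i) r w = (\sum_i (r i)^-1) * \prod_w r w.
Proof.
move=> r0; rewrite mulr_suml; apply: eq_bigr => i _.
by rewrite [in RHS](bigD1 i) //= mulKf.
Qed.

Definition nonlast : seq I := [seq i <- enum I | i != o].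

Lemma nonlastE i : (i \in nonlast) = (i != o).
Proof. by rewrite mem_filter mem_enum andbT. Qed.

(** Roots include every U for which some choice of the roots other than the
    last is degenerate.  It does not involve the last entry of d. *)
Definition bad_poly (d : I -> K) : {poly K} :=
  peval 1 (fun i => (d i)%:P * 'X) (fun=> 0) (qnorm nonlast crit_pexp).

Lemma bad_polyE (d q : I -> K) u : q o = 0 ->
  (forall i, i != o -> q i * (1 - q i) = d i * u) ->
  (bad_poly d).[u] = \prod_(A : {set I} | A \subset [set i | i != o])
     peval 1 (fun i => d i * u) (flip 1 A q) crit_pexp.
Proof.
move=> qo qd; rewrite -[LHS]/(horner_eval u (bad_poly d)) peval_morph rmorph1.
rewrite (@peval_ext _ _ _ _ (fun i => d i * u) _ (fun=> 0)); last 2 first.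
- by move=> i; rewrite /= /horner_eval hornerM hornerC hornerX.
- by move=> j _; rewrite /= rmorph0.
rewrite (peval_qnorm0 _ _ (q' := q)) => [|i]; last by rewrite nonlastE negbK => /eqP->.
have un : uniq nonlast by apply: filter_uniq; apply: enum_uniq.
rewrite peval_qnorm // => [|i]; last by rewrite nonlastE; apply: qd.
suff -> : [set i in nonlast] = [set i | i != o] by [].
by apply/setP => i; rewrite !inE nonlastE.
Qed.

Lemma rho_sum (q : I -> K) : \sum_i rho q i = (n - 2)%:R.
Proof.
rewrite /rho sumrB sumr_const -mulr_sumr (bigD1 o) //= /qfull eqxx.
rewrite (eq_bigr q) => [|i /negPf ->] //; rewrite subrK mulr1.
by rewrite natrB ?cardT -?cardE // ltnW.
Qed.

(** Powers of 2 make signed sums over nonempty sets nonzero; the factor 2 n keeps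
    them away from the small integers that occur in the estimates. *)
Definition weight (i : I) : nat := (2 * n * 2 ^ enum_rank i)%N.

(** The term of largest rank exceeds the sum of all the others. *)
Lemma weight_sum (B : {set I}) (r : I -> K) : B != set0 ->
  (forall i, i \in B -> `|r i| = (weight i)%:R) ->
  (2 * n)%:R <= `|\sum_(i in B) r i|.
Proof.
move=> /set0Pn[b bB] rB.
pose m := [arg max_(i > b in B) (enum_rank i : nat)].
have [mB mmax] : m \in B /\ forall i, i \in B -> (enum_rank i <= enum_rank m)%N.
  by rewrite /m; case: arg_maxnP.
rewrite (bigD1 m) //=.
have small : `|\sum_(i in B | i != m) r i| <= (2 * n * (2 ^ enum_rank m - 1))%:R.
  apply: le_trans (ler_norm_sum _ _ _) _.
  rewrite (eq_bigr (fun i => (weight i)%:R)) => [|i /andP[iB _]]; last exact: rB.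
  rewrite -natr_sum ler_nat -big_distrr /= leq_mul2l; apply/orP; right.
  have -> : (2 ^ enum_rank m - 1 = \sum_(j < enum_rank m) 2 ^ j)%N.
    by rewrite -[RHS]mul1n -(predn_exp 2) subn1.
  rewrite (big_ord_widen #|I| (fun j => 2 ^ j)%N); last exact/ltnW/ltn_ord.
  rewrite (reindex _ (onW_bij _ (enum_rank_bij I))) /=.
  rewrite big_mkcond [leqRHS]big_mkcond; apply: leq_sum => i _.
  case: ifP => // /andP[iB im]; rewrite ifT // ltn_neqAle mmax // andbT.
  by apply: contra im => /eqP/val_inj/enum_rank_inj ->.
have := lerB_normD (r m) (\sum_(i in B | i != m) r i).
rewrite rB //; apply: le_trans; rewrite lerBrDr.
apply: le_trans (lerD (lexx _) small) _.
by rewrite -natrD ler_nat /weight mulnBr muln1 subnKC // leq_pmulr // expn_gt0.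
Qed.

Section Good.
Variable q : I -> K.
Hypothesis q_weight : forall i, i != o -> `|1 - 2 * q i| = (weight i)%:R.

Lemma rho_nonlast i : i != o -> `|rho q i| = (weight i)%:R.
Proof. by move=> io; rewrite /rho /qfull (negPf io) q_weight. Qed.

Lemma rho_last : rho q o = (n - 2)%:R - \sum_(i | i != o) rho q i.
Proof. by rewrite -(rho_sum q) (bigD1 o) //= addrK. Qed.

(** If A contains the last place, pass to the complement, since the sum of all
    rho is the small number n - 2. *)
Lemma rho_subsum (A : {set I}) : A != set0 -> \sum_(i in A) rho q i != 0.
Proof.
move=> A0; case: (boolP (o \in A)) => oA; last first.
  rewrite -normr_gt0; apply: lt_le_trans (weight_sum A0 _).
    by rewrite ltr0n muln_gt0; apply: n_gt0.
  by move=> i iA; apply: rho_nonlast; apply: contraNneq oA => <-.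
have -> : \sum_(i in A) rho q i = (n - 2)%:R - \sum_(i in ~: A) rho q i.
  rewrite -(rho_sum q) [\sum_i rho q i](bigID (mem A)) /=.
  rewrite [X in _ = _ + X - _](eq_bigl (mem (~: A))) ?addrK // => i.
  by rewrite /= inE.
have [->|nA] := eqVneq (~: A) set0.
  by rewrite big_set0 subr0 pnatr_eq0; lia.
rewrite subr_eq0; apply/eqP => h.
have : (2 * n)%:R <= `|(n - 2)%:R : K|.
  rewrite h; apply: weight_sum => // i; rewrite inE => iA.
  by apply: rho_nonlast; apply: contraNneq iA => ->.
by rewrite normr_nat ler_nat; lia.
Qed.

Lemma rho_neq0 i : rho q i != 0.
Proof.
have := @rho_subsum [set i]; rewrite big_set1; apply.
by apply/set0Pn; exists i; rewrite set11.
Qed.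

Lemma rho_norm i : n%:R < `|rho q i|.
Proof.
have [->|io] := eqVneq i o; last first.
  rewrite rho_nonlast // ltr_nat /weight.
  have := expn_gt0 2 (enum_rank i); nia.
have B0 : [set i | i != o] != set0.
  have -> : [set i | i != o] = [set~ o] by apply/setP => j; rewrite !inE.
  by rewrite -card_gt0 cardsC1; lia.
have : (2 * n)%:R <= `|\sum_(i in [set i | i != o]) rho q i|.
  by apply: weight_sum => // j; rewrite inE => jo; apply: rho_nonlast.
rewrite (eq_bigl (fun i => i != o)) => [h|j]; last by rewrite inE.
rewrite rho_last distrC; apply: lt_le_trans (lerB_dist _ _).
rewrite normr_nat ltrBrDr; apply: lt_le_trans h.
by rewrite -natrD ltr_nat; lia.
Qed.

(** All rho are larger than n in absolute value, so the sum of their inverses is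
    smaller than 1, hence different from n - 2. *)
Lemma crit_neq0 (e : I -> K) : peval 1 e q crit_pexp != 0.
Proof.
rewrite peval_crit mulf_neq0 //; last by apply/prodf_neq0 => A; apply: rho_subsum.
rewrite sum_prod_others; last exact: rho_neq0.
rewrite -mulrBl mulf_neq0 //; last by apply/prodf_neq0 => i _; apply: rho_neq0.
rewrite subr_eq0; apply/eqP => h.
have : 1 <= `|\sum_i (rho q i)^-1| by rewrite h normr_nat ler1n; lia.
apply/negP; rewrite -real_ltNge ?realE ?normr_ge0 ?ler01 //.
apply: le_lt_trans (ler_norm_sum _ _ _) _.
have n0 : 0 < n%:R :> K by rewrite ltr0n; lia.
have -> : 1 = \sum_(i : I) (n%:R)^-1 :> K.
  by rewrite sumr_const -[RHS]mulr_natr mulVf ?gt_eqF.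
apply: ltr_sum => [|i _].
  by apply/hasP; exists o => //; rewrite mem_index_enum.
by rewrite normfV ltf_pV2 ?rho_norm // posrE // normr_gt0 rho_neq0.
Qed.

End Good.

(** Since 4 u d_i = 1 - rho_i^2, four times u times the sum of d_i / rho_i
    is sum 1/rho - sum rho, and sum rho = n - 2. *)
Lemma crit_degrees (d q : I -> K) u : u != 0 ->
  (forall i, q i * (1 - q i) = d i * u) -> \sum_i q i = 1 ->
  peval 1 (fun i => d i * u) q crit_pexp != 0 ->
  [/\ forall i, 1 - 2 * q i != 0,
      forall A : {set I}, A != set0 -> \sum_i flip 1 A q i != 1
    & \sum_i d i / (1 - 2 * q i) != 0].
Proof.
move=> u0 qd q1; rewrite peval_crit mulf_eq0 negb_or => /andP[cr /prodf_neq0 rA].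
have rE i : rho q i = 1 - 2 * q i.
  rewrite /rho /qfull; case: eqP => // ->.
  by rewrite -q1 (bigD1 o) //= addrK.
have A0 (A : {set I}) : A != set0 -> \sum_(i in A) (1 - 2 * q i) != 0.
  by move=> /rA; rewrite (eq_bigr _ (fun i _ => rE i)).
have q2 i : 1 - 2 * q i != 0.
  have := A0 [set i]; rewrite big_set1; apply.
  by apply/set0Pn; exists i; rewrite set11.
split=> // [A /A0|].
  have -> : \sum_(i in A) (1 - 2 * q i) = \sum_i flip 1 A q i - \sum_i q i.
    rewrite -sumrB [LHS]big_mkcond; apply: eq_bigr => i _.
    by rewrite /flip; case: ifP => _; ring.
  by rewrite q1 subr_eq0.
apply: contraNneq cr => s0.
rewrite sum_prod_others => [|i]; last by rewrite rE.
rewrite -(rho_sum q) -mulrBl -sumrB.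
rewrite [X in X * _](_ : _ = 4 * u * \sum_i d i / (1 - 2 * q i)).
  by rewrite s0 mulr0 mul0r.
rewrite mulr_sumr; apply: eq_bigr => i _; rewrite rE.
have -> : 4 * u * (d i / (1 - 2 * q i)) = 4 * (d i * u) / (1 - 2 * q i) by ring.
by rewrite -qd; field; rewrite q2.
Qed.


(** With d_i = w_i^2 - 1 away from o, the roots at U = -1/4 are (1 +- w_i) / 2,
    so [bad_poly] is nonzero there and has finitely many roots.  Each of the
    conditions of [regular_degreesI] then excludes finitely many values y of the
    entry at o. *)
Lemma exists_regular_degrees : exists d : I -> K, regular_degrees d.
Proof.
pose dJ i : K := if i == o then 0 else (weight i)%:R ^+ 2 - 1.
have dJo i : i != o -> dJ i = (weight i)%:R ^+ 2 - 1 by rewrite /dJ => /negPf ->.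
(* Only the entries away from o matter for the bad values of U. *)
pose b := bad_poly dJ.
have b0 : b != 0.
  pose q i : K := if i == o then 0 else (1 - (weight i)%:R) / 2.
  suff : b.[- 4^-1] != 0 by apply: contraNneq => ->; rewrite horner0.
  rewrite (bad_polyE (q := q)) /q ?eqxx // => [|i io]; last first.
    by rewrite (negPf io) dJo //; move: (weight i)%:R => w; field.
  apply/prodf_neq0 => A sA; apply: crit_neq0 => i io.
  rewrite /flip (negPf io) -[RHS]normr_nat; case: ifP => _.
    by rewrite -normrN; congr `|_|; move: (weight i)%:R => w; field.
  by congr `|_|; move: (weight i)%:R => w; field.
have [rs rsE] : exists rs : seq K, forall u, root b u -> u \in rs.
  have [rs bE] := closed_field_poly_normal b; exists rs => u.
  by rewrite bE rootZ ?lead_coef_eq0 // root_prod_XsubC.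
(* The choices of roots at u and at infinity, up to flips, away from o. *)
pose qJ u i : K := if i == o then 0 else qroot 1 (fun i => dJ i * u) i.
pose thJ i : K := if i == o then 0 else qroot 0 dJ i.
pose yq u (A : {set I}) : K :=
  let x := 1 - \sum_(i | i != o) flip 1 A (qJ u) i in x * (1 - x) / u.
pose yth (A : {set I}) : K := - (\sum_(i | i != o) flip 0 A thJ i) ^+ 2.
have [y] := exists_notin (0 :: [seq dJ i | i <- enum I] ++
   [:: \sum_(i | i != o) dJ i] ++
   [seq dJ j - \sum_(i | (i != o) && (i != j)) dJ i | j <- enum I] ++
   [seq yth A | A : {set I} <- enum {set I}] ++
   [seq yq u A | u <- rs, A : {set I} <- enum {set I}]).
rewrite inE !mem_cat !negb_or => /and5P[y0 yd ys yl /andP[yt yb]].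
rewrite andbT in ys.
pose d i := if i == o then y else dJ i.
have dJd i : i != o -> d i = dJ i by rewrite /d => /negPf ->.
have dJ_nz i : i != o -> dJ i != 0.
  move=> io; rewrite dJo // subr_eq0 -natrX pnatr_eq1 /weight.
  have := expn_gt0 2 (enum_rank i); nia.
have dJ_neq j : y != dJ j.
  by apply: contraNneq yd => ->; apply/mapP; exists j; rewrite ?mem_enum.
exists d; apply: regular_degreesI => //.
- by move=> j; rewrite /d; case: (eqVneq j o) => // /dJ_nz.
- move=> i j; rewrite /d; case: (eqVneq i o) => [->|io]; case: (eqVneq j o) => [->|jo] //.
  + by move=> h; case/eqP: (dJ_neq j).
  + by move=> h; case/eqP: (dJ_neq i).
  rewrite !dJo // => /addIr/eqP; rewrite -!natrX eqr_nat eqn_sqr /weight.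
  have n2 : (0 < 2 * n)%N by rewrite muln_gt0.
  by rewrite eqn_pmul2l // eqn_exp2l // => /eqP/val_inj/enum_rank_inj.
- move=> j; case: (eqVneq j o) => [->|jo].
    by rewrite /d eqxx (eq_bigr dJ) // => i /negPf ->.
  rewrite dJd // (bigD1 o) //= 1?eq_sym // {1}/d eqxx.
  rewrite (eq_bigl (fun i => (i != o) && (i != j))); last by move=> i; rewrite andbC.
  rewrite (eq_bigr dJ) => [|i /andP[io _]]; last exact: dJd.
  by apply: contraNneq yl => h; apply/mapP; exists j; rewrite ?mem_enum // -h addrK.
- pose th := qroot 0 d.
  have thd i : th i * (0 - th i) = d i by apply: qrootP.
  rewrite (sumnormE thd); apply/prodf_neq0 => A _; rewrite sub0r oppr_eq0.
  rewrite (bigD1 o) //=; apply: contraNneq yt => h; apply/mapP; exists A; rewrite ?mem_enum //.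
  have {}h : flip 0 A th o = - \sum_(i | i != o) flip 0 A th i.
    by apply/eqP; rewrite -addr_eq0 h.
  have := flip_root 0 A th o; rewrite thd h {1}/d eqxx sub0r opprK => <-.
  rewrite /yth expr2 mulNr; congr (- (_ * _)); apply: eq_bigr => i io;
    by rewrite /flip /thJ (negPf io) /th /qroot /d (negPf io).
move=> u q u0 qd q1; apply: (crit_degrees u0 qd q1); apply: contraNneq yb => W0.
pose q0 i := if i == o then 0 else q i.
have q0o : q0 o = 0 by rewrite /q0 eqxx.
have q0d j : q0 j * (1 - q0 j) = dJ j * u.
  rewrite /q0; case: (eqVneq j o) => [->|jo]; last by rewrite qd dJd.
  by rewrite mul0r /dJ eqxx mul0r.
have ur : u \in rs.
  apply: rsE; rewrite rootE (bad_polyE q0o) => [|i _]; last exact: q0d.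
  rewrite (bigD1 set0) ?sub0set //.
  suff -> : peval 1 (fun i => dJ i * u) (flip 1 set0 q0) crit_pexp = 0.
    by apply/eqP; apply: mul0r.
  rewrite -W0; apply: crit_ext => i io.
  by rewrite /flip inE /q0 (negPf io).
pose A := [set i | q i != qJ u i].
apply/allpairsP; exists (u, A); split; rewrite ?mem_enum //=.
have fl i : i != o -> flip 1 A (qJ u) i = q i.
  move=> io; have qJd j : qJ u j * (1 - qJ u j) = dJ j * u.
    rewrite /qJ; case: (eqVneq j o) => [->|_]; last exact: qrootP.
    by rewrite mul0r /dJ eqxx mul0r.
  have -> : q i = q0 i by rewrite /q0 (negPf io).
  by rewrite (flip_setE qJd q0d) /flip !inE /q0 (negPf io).
rewrite /yq (eq_bigr q); last exact: fl.
have -> : 1 - \sum_(i | i != o) q i = q o by rewrite -q1 (bigD1 o) //= addrK.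
by rewrite qd /d eqxx mulfK.
Qed.

End Existence.

(** * Solutions on a complete graph *)

(** Counting by an explicit enumeration, which transfers directly along
    bijections and to dependent products. *)
Definition has_card (X : Type) (A : X -> Prop) (m : nat) : Prop :=
  exists F : 'I_m -> X, injective F /\ forall x, A x <-> exists i, x = F i.

Section CompleteGraph.
Variables (V : finType) (K : numClosedFieldType).
Implicit Types (p : V -> V -> K) (d : V -> K).

(** Points of the coordinate space, seen as symmetric functions that vanish on
    the diagonal. *)
Definition weighting p : Prop :=
  (forall x y, p x y = p y x) /\ (forall x, p x x = 0).

Definition degree p x : K := \sum_y p x y.

Definition quadrics p : Prop := forall t u v w, uniq [:: t; u; v; w] ->
  p t u * p v w = p t v * p u w.

Definition complete_solution d p : Prop :=
  [/\ weighting p, degree p =1 d & quadrics p].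

Section Regular.
Hypothesis V_gt2 : (2 < #|V|)%N.
Variable d : V -> K.
Hypothesis regd : regular_degrees d.

Lemma three_vertices : exists a b c : V, uniq [:: a; b; c].
Proof.
move: V_gt2; rewrite cardE; case E : (enum V) => [|a [|b [|c s]]] // _.
exists a, b, c; have := enum_uniq V; rewrite E /=.
by rewrite !inE !negb_or => /and4P[/and3P[-> -> _] /andP[-> _] _ _].
Qed.

(** Suppose p_ab = 0.  As d_a is nonzero, p_ac is nonzero for some c.  The
    quadrics on {a, b, c, e} kill p_be, then p_bc = d_b is nonzero and they kill
    p_ae, and finally those on {a, c, x, y} kill p_xy: all the weight is on edges
    at c, so d_c is the sum of the other degrees. *)
Lemma solution_neq0 p x y : complete_solution d p -> x != y -> p x y != 0.
Proof.
have [d0 dstar _ _] := regular_degreesP V_gt2 regd.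
move=> [[psym pdiag] pdeg pq]; move: x y => a b ab; apply/eqP => pab.
have [c pac] : exists c, p a c != 0.
  apply/existsP; rewrite -[[exists _, _]]negbK negb_exists; apply/negP => /forallP h.
  have := d0 a; rewrite -pdeg /degree big1 ?eqxx // => c _.
  by have := h c; rewrite negbK => /eqP.
have ca : c != a by apply: contraNneq pac => ->; rewrite pdiag.
have cb : c != b by apply: contraNneq pac => ->; rewrite pab.
have pbe e : e != c -> p b e = 0.
  move=> ec; have [->|ea] := eqVneq e a; first by rewrite psym.
  have [->|eb] := eqVneq e b; first exact: pdiag.
  have /pq : uniq [:: a; b; c; e].
    by rewrite /= !inE !negb_or ab (eq_sym a) ca (eq_sym a) ea (eq_sym b) cb
      (eq_sym b) eb (eq_sym c) ec.
  by rewrite pab mul0r => /esym/eqP; rewrite mulf_eq0 (negPf pac) => /eqP.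
have pbc : p b c != 0.
  by have := d0 b; rewrite -pdeg /degree (bigD1 c) //= big1 ?addr0.
have pae e : e != c -> p a e = 0.
  move=> ec; have [->|ea] := eqVneq e a; first exact: pdiag.
  have [->|eb] := eqVneq e b; first exact: pab.
  have /pq : uniq [:: b; a; c; e].
    by rewrite /= !inE !negb_or (eq_sym b) ab (eq_sym b) cb (eq_sym b) eb
      (eq_sym a) ca (eq_sym a) ea (eq_sym c) ec.
  by rewrite psym pab mul0r => /esym/eqP; rewrite mulf_eq0 (negPf pbc) => /eqP.
(* Edges that avoid c have weight 0. *)
have star x y : x != c -> y != c -> p x y = 0.
  move=> xc yc; have [->|xa] := eqVneq x a; first exact: pae.
  have [->|ya] := eqVneq y a; first by rewrite psym pae.
  have [->|xy] := eqVneq x y; first exact: pdiag.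
  have /pq : uniq [:: a; c; x; y].
    by rewrite /= !inE !negb_or (eq_sym a) ca (eq_sym a) xa (eq_sym a) ya
      (eq_sym c) xc (eq_sym c) yc xy.
  by rewrite (pae _ xc) mul0r => /eqP; rewrite mulf_eq0 (negPf pac) => /eqP.
case/eqP: (dstar c); rewrite -pdeg /degree (bigD1 c) //= pdiag add0r.
apply: eq_bigr => x xc; rewrite -pdeg /degree (bigD1 c) //= big1 ?addr0 //.
by move=> y yc; apply: star.
Qed.

(** Put th_a^2 = p_ab p_ac / p_bc on a triangle and th_x = p_ax / th_a for the
    other x; the quadrics on sets containing a give the remaining identities. *)
Lemma solution_rank1 p : complete_solution d p ->
  exists th : V -> K, forall x y, x != y -> p x y = th x * th y.
Proof.
move=> sol; have p0 := solution_neq0 sol; case: sol => [[psym _] _ pq].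
have [a [b [c]]] := three_vertices; rewrite /= !inE !negb_or andbT.
move=> /andP[/andP[ab ac] bc].
pose r := sqrtC (p a b * p a c / p b c).
have rE : r ^+ 2 = p a b * p a c / p b c by rewrite sqrtCK.
have r2 : r ^+ 2 * p b c = p a b * p a c by rewrite rE divfK ?p0.
have r0 : r != 0.
  have : r ^+ 2 != 0 by rewrite rE !mulf_neq0 ?invr_eq0 ?p0.
  by rewrite expf_eq0.
exists (fun x => if x == a then r else p a x / r) => x y xy.
wlog xa : x y xy / x != a.
  move=> H; have [xa|] := eqVneq x a; last by move=> xa; rewrite H ?(negPf xa).
  by rewrite psym H 1?eq_sym -?xa // xa eqxx mulrC; case: eqP.
rewrite (negPf xa); have [->|ya] := eqVneq y a; first by rewrite divfK // psym.
suff E : p x y * r ^+ 2 = p a x * p a y.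
  by apply: (mulIf (expf_neq0 2 r0)); rewrite E; field; rewrite r0.
apply: (mulIf (p0 _ _ bc)); rewrite -mulrA r2.
have key v w : v != a -> v != b -> v != c -> w != a -> w != v ->
    p v w * (p a b * p a c) = p a v * p a w * p b c.
  move=> va vb vc wa wv.
  have uv : uniq [:: a; b; c; v].
    by rewrite /= !inE !negb_or ab ac bc !(eq_sym _ v) va vb vc.
  have E2 := pq _ _ _ _ uv.
  have uv' : uniq [:: a; b; v; c].
    by rewrite /= !inE !negb_or ab ac bc !(eq_sym _ v) va vb vc.
  have E1 := pq _ _ _ _ uv'.
  have [->|wb] := eqVneq w b.
    have -> : p a v * p a b * p b c = p a b * (p a v * p b c) by ring.
    by rewrite -E1 (psym v c) E2 (psym v b); ring.
  have [->|wc] := eqVneq w c.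
    have -> : p a v * p a c * p b c = p a c * (p a v * p b c) by ring.
    by rewrite -E1; ring.
  have uw : uniq [:: a; w; v; c].
    by rewrite /= !inE !negb_or (eq_sym a w) wa (eq_sym a v) va ac wv wc vc.
  have E3 := pq _ _ _ _ uw.
  have uw' : uniq [:: a; c; v; w].
    rewrite /= !inE !negb_or (eq_sym a w) wa (eq_sym a v) va ac.
    by rewrite (eq_sym v w) wv (eq_sym c w) wc (eq_sym c) vc.
  have E4 := pq _ _ _ _ uw'.
  have -> : p a v * p a w * p b c = p a w * (p a v * p b c) by ring.
  rewrite -E1; have -> : p a w * (p a b * p v c) = p a b * (p a w * p v c) by ring.
  by rewrite E3 (psym w c) -E4; ring.
have [xb|xb] := eqVneq x b; last have [xc|xc] := eqVneq x c.
- have [yc|yc] := eqVneq y c; first by rewrite xb yc; ring.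
  by rewrite xb psym key ?[_ == b]eq_sym -?xb //; ring.
- have [yb|yb] := eqVneq y b; first by rewrite xc yb (psym c b); ring.
  by rewrite xc psym key ?[_ == c]eq_sym -?xc //; ring.
by apply: key; rewrite // eq_sym.
Qed.

Lemma third_vertex (x y : V) : exists z, z != x /\ z != y.
Proof.
have : (0 < #|[set: V] :\ x :\ y|)%N.
  have := cardsD1 x [set: V]; have := cardsD1 y ([set: V] :\ x).
  rewrite cardsT; have := V_gt2.
  by case: (x \in _); case: (y \in _) => /=; lia.
by rewrite card_gt0 => /set0Pn[z]; rewrite !inE andbT => /andP[? ?]; exists z.
Qed.

Definition root_weighting (q : V -> K) (u : K) : V -> V -> K :=
  fun x y => if x == y then 0 else q x * q y / u.

Lemma root_weightingP q u : u != 0 -> (forall x, q x * (1 - q x) = d x * u) ->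
  \sum_x q x = 1 -> complete_solution d (root_weighting q u).
Proof.
move=> u0 qd q1; split; first split.
- by move=> x y; rewrite /root_weighting eq_sym [q x * _]mulrC.
- by move=> x; rewrite /root_weighting eqxx.
- move=> x; rewrite /degree (bigD1 x) //= {1}/root_weighting eqxx add0r.
  rewrite (eq_bigr (fun y => q y * (q x / u))).
    rewrite -mulr_suml; have -> : \sum_(y | y != x) q y = 1 - q x.
      by have := q1; rewrite (bigD1 x) //= => <-; rewrite [q x + _]addrC addrK.
    by rewrite mulrA [_ * q x]mulrC qd mulfK.
  by move=> y yx; rewrite /root_weighting eq_sym (negPf yx) mulrAC mulrC mulrCA mulrA.
move=> t w v z; rewrite /= !inE !negb_or => /and4P[/and3P[tw tv tz] /andP[wv wz] vz _].
by rewrite /root_weighting !ifN //; ring.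
Qed.

(** Injectivity: q_x q_y / U for all x <> y determines q up to a factor when
    there are at least three vertices, and the factor is 1 because sum q = 1. *)
Lemma complete_count : has_card (complete_solution d) (hypersimplex_degree V).
Proof.
have [d0 _ th0 [rs [urs srs rsE rsI]]] := regular_degreesP V_gt2 regd.
have inrs (i : 'I_(hypersimplex_degree V)) : rs`_i \in rs by rewrite mem_nth // srs.
have /boolp.choice[Q QE] : forall i : 'I_(hypersimplex_degree V), exists q,
    [/\ forall x, q x * (1 - q x) = d x * rs`_i, \sum_x q x = 1 &
      forall q', (forall x, q' x * (1 - q' x) = d x * rs`_i) ->
                \sum_x q' x = 1 -> q' =1 q].
  by move=> i; have [_] := rsE _ (inrs i).
have r0 (i : 'I_(hypersimplex_degree V)) : rs`_i != 0 by have [] := rsE _ (inrs i).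
have Q0 i x : Q i x != 0.
  have [qd _ _] := QE i; have : d x * rs`_i != 0 by rewrite mulf_neq0.
  by rewrite -qd mulf_eq0 negb_or => /andP[].
exists (fun i => root_weighting (Q i) rs`_i); split.
  move=> i j ij.
  have E x y : x != y -> Q i x * Q i y * rs`_j = Q j x * Q j y * rs`_i.
    move=> xy; have := congr1 (fun f => f x y) ij.
    rewrite /root_weighting (negPf xy) => /(congr1 (fun z => z * (rs`_i * rs`_j))).
    by rewrite !mulrA divfK // [_ * _ * rs`_j in RHS]mulrAC divfK.
  have cross x y : Q i x * Q j y = Q i y * Q j x.
    have [z [zx zy]] := third_vertex x y.
    have Ex := E x z; have Ey := E y z.
    rewrite eq_sym in zx; rewrite eq_sym in zy.
    have : (Q i x * Q j y) * (Q i z * rs`_j * Q j z * rs`_i) =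
           (Q i y * Q j x) * (Q i z * rs`_j * Q j z * rs`_i).
      transitivity ((Q i x * Q i z * rs`_j) * (Q j y * Q j z * rs`_i)); first by ring.
      by rewrite Ex // -Ey //; ring.
    by move/mulIf; apply; rewrite !mulf_neq0.
  have Qij x : Q i x = Q j x.
    have [_ Qi1 _] := QE i; have [_ Qj1 _] := QE j.
    rewrite -[LHS]mulr1 -Qj1 mulr_sumr (eq_bigr _ (fun y _ => cross x y)).
    by rewrite -mulr_suml Qi1 mul1r.
  have [a [b [c]]] := three_vertices; rewrite /= !inE negb_or => /andP[/andP[ab _] _].
  have := E a b ab; rewrite !Qij => /mulfI rij.
  apply/val_inj/eqP; rewrite /= -(nth_uniq 0 _ _ urs) ?srs ?ltn_ord //.
  by rewrite rij // mulf_neq0.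
move=> p; split; last first.
  move=> [i ->]; have [qd q1 _] := QE i; exact: root_weightingP.
move=> sol; have [th thE] := solution_rank1 sol; case: (sol) => [[psym pdiag] pdeg _].
pose S := \sum_x th x.
have thS x : th x * (S - th x) = d x.
  rewrite -pdeg /degree (bigD1 x) //= pdiag add0r.
  have -> : S - th x = \sum_(y | y != x) th y.
    by rewrite /S (bigD1 x) //= [th x + _]addrC addrK.
  by rewrite mulr_sumr; apply: eq_bigr => y yx; rewrite thE // eq_sym.
have S0 : S != 0.
  apply/negP => /eqP S0; have thd x : th x ^+ 2 = - d x.
    by rewrite -thS S0 sub0r mulrN opprK expr2.
  by have := th0 th thd; rewrite -/S S0 eqxx.
pose q x := th x / S; pose u := S ^- 2.
have u0 : u != 0 by rewrite invr_eq0 expf_neq0.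
have qd x : q x * (1 - q x) = d x * u.
  by rewrite -thS /q /u; field.
have q1 : \sum_x q x = 1 by rewrite -mulr_suml divff.
have ur := rsI u q u0 qd q1.
have iP : (index u rs < hypersimplex_degree V)%N by rewrite -srs index_mem.
exists (Ordinal iP); have [_ _ qU] := QE (Ordinal iP).
rewrite /= nth_index // in qU *.
apply/funext => x; apply/funext => y; rewrite /root_weighting.
case: eqVneq => [->|xy]; first exact: pdiag.
by rewrite thE // -!(qU q qd q1) /q /u; field.
Qed.

End Regular.

(** The polynomial [regpoly] of the tuple of variables is a polynomial over
    multivariate polynomials that specializes to [regpoly] of every d. *)
Lemma generic_regular : (2 < #|V|)%N -> exists f : {mpoly K[#|V|]},
  (exists d, f.@[d \o enum_val] != 0) /\
  forall d, f.@[d \o enum_val] != 0 -> regular_degrees d.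
Proof.
move=> V2; have /card_gt0P[o _] : (0 < #|V|)%N by apply: ltnW (ltnW V2).
have [d [sd sepd]] := exists_regular_degrees K V2 o.
pose k : {poly {mpoly K[#|V|]}} := regpoly (fun x : V => 'X_(enum_rank x)).
have kE e : map_poly (meval (e \o enum_val)) k = regpoly e.
  rewrite map_regpoly; congr regpoly; apply/funext => x /=.
  by rewrite mevalXU /= enum_rankK.
have [||||f [fd fP]] :=
  @generic_separable K #|V| (1 + hypersimplex_degree V + #|V|) k (d \o enum_val).
- by rewrite addn_gt0 (ltnW (ltnW V2)) orbT.
- by have [] := regpoly_top (fun x : V => 'X_(enum_rank x) : {mpoly K[#|V|]}).
- by rewrite kE.
- by rewrite kE.
exists f; split; first by exists d.
by move=> e /fP; rewrite kE.
Qed.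

(** Already the weightings of the form a_x + a_y realize all degrees. *)
Lemma degree_surj d : (2 < #|V|)%N ->
  exists p, weighting p /\ degree p = d.
Proof.
move=> V2; pose s := (\sum_x d x) / (2 * #|V| - 2)%:R.
pose a x := (d x - s) / (#|V| - 2)%:R.
have n2 : (#|V| - 2)%:R != 0 :> K by rewrite pnatr_eq0; lia.
have n22 : (2 * #|V| - 2)%:R != 0 :> K by rewrite pnatr_eq0; lia.
have sa : \sum_x a x = s.
  have sc : \sum_(x : V) s = s * #|V|%:R by rewrite sumr_const mulr_natr.
  rewrite -mulr_suml sumrB sc.
  apply: (mulIf n2); rewrite divfK //.
  have -> : \sum_x d x = s * (2 * #|V| - 2)%:R by rewrite divfK.
  rewrite -mulrBr -natrB; last by lia.
  by congr (_ * _%:R); lia.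
exists (fun x y => if x == y then 0 else a x + a y); split; first split.
- by move=> x y; rewrite eq_sym addrC.
- by move=> x; rewrite eqxx.
apply/funext => x; rewrite /degree (bigD1 x) //= eqxx add0r.
rewrite (eq_bigr (fun y => a x + a y)) => [|y yx]; last by rewrite eq_sym (negPf yx).
rewrite big_split /= sumr_const.
have -> : \sum_(y | y != x) a y = s - a x.
  by rewrite -sa [in RHS](bigD1 x) //= [a x + _]addrC addrK.
have -> : #|(fun y => y != x)| = (#|V| - 2).+1.
  by have := cardC1 x; rewrite -subn1 => ->; lia.
by rewrite mulrSr -mulr_natr addrACA subrr addr0 divfK // subrK.
Qed.

(** With one edge the degrees determine the weight, but the two degrees are equal,
    hence not generic: this is why the count for n = 2 is 1 and not
    2^(n-1) - n = 0. *)
Lemma two_vertices p : #|V| = 2 -> weighting p ->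
  has_card (complete_solution (degree p)) 1.
Proof.
move=> V2 wp; exists (fun=> p); split; first by move=> i j _; rewrite !ord1.
have degE q x y : weighting q -> x != y -> q x y = degree q x.
  move=> [_ q0] xy; have /eqP/cards1P[z zE] : #|[set~ x]| = 1%N by rewrite cardsC1 V2.
  have -> : y = z by apply/set1P; rewrite -zE !inE eq_sym.
  rewrite /degree (bigD1 x) //= q0 add0r (eq_bigl (mem [set z])).
    by rewrite big_set1.
  by move=> w; rewrite -zE /= !inE.
move=> q; split.
  move=> [wq dq _]; exists ord0; apply/funext => x; apply/funext => y.
  have [->|xy] := eqVneq x y; first by rewrite wq.2 wp.2.
  by rewrite (degE _ _ _ wq xy) dq degE.
move=> [_ ->]; split=> // t u v w un.
by have := max_card (mem [:: t; u; v; w]); rewrite (card_uniqP un) V2.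
Qed.

Definition complete_mldeg (n : nat) : nat :=
  if n == 2%N then 1%N else (2 ^ (n - 1) - n)%N.

Lemma complete_generic : (1 < #|V|)%N -> exists f : {mpoly K[#|V|]},
  (exists p, weighting p /\ f.@[degree p \o enum_val] != 0) /\
  forall p, weighting p -> f.@[degree p \o enum_val] != 0 ->
    has_card (complete_solution (degree p)) (complete_mldeg #|V|).
Proof.
move=> V1; rewrite /complete_mldeg; case: eqP => V2.
  exists 1; split; first by exists (fun _ _ => 0); rewrite meval1 oner_eq0.
  by move=> p wp _; apply: two_vertices.
have {}V2 : (2 < #|V|)%N by lia.
have [f [[d fd] fP]] := generic_regular V2; exists f; split.
  by have [p [wp dp]] := degree_surj d V2; exists p; rewrite dp.
by move=> p wp /fP; apply: complete_count.
Qed.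

End CompleteGraph.

(** * Zariski genericity, cardinalities and coordinates *)

Section Genericity.
Variables (K : numFieldType) (m : nat).
Implicit Types (P Q : 'cV[K]_m -> Prop).

Definition polyfun (F : 'cV[K]_m -> K) : Prop :=
  exists f : {mpoly K[m]}, forall u, F u = f.@[fun i => u i ord0].

(** In terms of a single polynomial that does not vanish: conjunctions then become
    products. *)
Lemma generic_polyfun P : generic P <->
  exists F, [/\ polyfun F, exists u, F u != 0 & forall u, F u != 0 -> P u].
Proof.
split.
  move=> [_ [[S ->] ZT PZ]].
  have [u] : exists u : 'cV[K]_m, ~ (forall f, S f -> f.@[fun i => u i ord0] = 0).
    apply/existsNP => h; case: ZT; rewrite -classical_sets.subTset => u _; exact: h.
  move=> /existsNP[f /not_implyP[Sf /eqP fu]].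
  exists (fun u => f.@[fun i => u i ord0]); split; [by exists f | by exists u |].
  by move=> v fv; apply: PZ => /(_ f Sf)/eqP; rewrite (negPf fv).
move=> [F [[f fE] [u Fu] FP]].
exists [set u | forall g, [set f]%classic g -> g.@[fun i => u i ord0] = 0]%classic.
split; first by exists [set f]%classic.
  move=> h; have : [set: 'cV[K]_m]%classic u by [].
  by rewrite -h => /(_ f erefl)/eqP; rewrite -fE (negPf Fu).
move=> v nv; apply: FP; rewrite fE; apply/eqP => fv.
by apply: nv => g ->.
Qed.

Lemma polyfun_const c : polyfun (fun=> c).
Proof. by exists c%:MP => u; rewrite mevalC. Qed.

Lemma polyfun_coef i : polyfun (fun u => u i ord0).
Proof. by exists 'X_i => u; rewrite mevalXU. Qed.

Lemma polyfun_sum (J : Type) (s : seq J) (A : pred J) (F : J -> 'cV[K]_m -> K) :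
  (forall j, polyfun (F j)) -> polyfun (fun u => \sum_(j <- s | A j) F j u).
Proof.
move=> /boolp.choice[f fE]; exists (\sum_(j <- s | A j) f j) => u.
by rewrite raddf_sum; apply: eq_bigr => j _; apply: fE.
Qed.

Lemma polyfun_comp r (f : {mpoly K[r]}) (F : 'I_r -> 'cV[K]_m -> K) :
  (forall i, polyfun (F i)) -> polyfun (fun u => f.@[fun i => F i u]).
Proof.
move=> /boolp.choice[g gE]; exists (f \mPo [tuple g i | i < r]) => u.
rewrite comp_mpoly_meval; apply: meval_eq => i.
by rewrite tnth_mktuple gE.
Qed.

(** Restriction to a line reduces the irreducibility of affine space to
    polynomials in one variable. *)
Lemma polyfun_line F u v : polyfun F ->
  exists p : {poly K}, forall s, p.[s] = F (u + s *: v).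
Proof.
move=> [f fE].
exists (mmap (@polyC K) (fun i => (u i ord0)%:P + (v i ord0)%:P * 'X) f) => s.
rewrite fE /mmap mevalE horner_sum; apply: eq_bigr => M _.
rewrite hornerM hornerC; congr (_ * _).
rewrite /mmap1 horner_prod; apply: eq_bigr => i _.
by rewrite horner_exp hornerD hornerM hornerX !hornerC !mxE mulrC.
Qed.

Lemma generic_exists P : generic P -> exists u, P u.
Proof. by move=> /generic_polyfun[F [_ [u Fu] FP]]; exists u; apply: FP. Qed.

Lemma generic_true P : (forall u, P u) -> generic P.
Proof.
move=> hP; apply/generic_polyfun; exists (fun=> 1); split=> //.
  exact: polyfun_const.
by exists 0; apply: oner_neq0.
Qed.

(** Join a point where F is nonzero to a point where G is nonzero by a line: on
    it both are nonzero polynomials, so some point is good for both. *)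
Lemma generic_and P Q : generic P -> generic Q -> generic (fun u => P u /\ Q u).
Proof.
move=> /generic_polyfun[F [[f fE] [u Fu] FP]] /generic_polyfun[G [[g gE] [v Gv] GQ]].
apply/generic_polyfun; exists (fun u => F u * G u); split; last 1 first.
- by move=> w; rewrite mulf_eq0 negb_or => /andP[/FP ? /GQ].
- by exists (f * g) => w; rewrite mevalM fE gE.
have [p pE] := polyfun_line u (v - u) (ex_intro _ f fE).
have [q qE] := polyfun_line u (v - u) (ex_intro _ g gE).
have p0 : p != 0.
  by apply: contraNneq Fu => p0; have := pE 0; rewrite scale0r addr0 p0 horner0 => <-.
have q0 : q != 0.
  apply: contraNneq Gv => q0; have := qE 1.
  by rewrite scale1r addrC subrK q0 horner0 => <-.
have [s] := exists_notroot (mulf_neq0 p0 q0).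
rewrite rootM negb_or !rootE pE qE => /andP[? ?].
by exists (u + s *: (v - u)); apply: mulf_neq0.
Qed.

Lemma generic_all (J : finType) (P : J -> 'cV[K]_m -> Prop) :
  (forall j, generic (P j)) -> generic (fun u => forall j, P j u).
Proof.
move=> gP; suff : forall s : seq J, generic (fun u => forall j, j \in s -> P j u).
  move=> /(_ (enum J)) /generic_polyfun[F [Fp Fu FP]]; apply/generic_polyfun.
  by exists F; split=> // u /FP h j; apply: h; rewrite mem_enum.
elim=> [|i s IH]; first by apply: generic_true.
have /generic_polyfun[F [Fp Fu FP]] := generic_and (gP i) IH.
apply/generic_polyfun; exists F; split=> // u /FP[Pi Ps] j.
by rewrite inE => /predU1P[->//|/Ps].
Qed.

End Genericity.

Section Cardinality.

Lemma has_card_fin (X : Type) (A : X -> Prop) (T : finType) (F : T -> X) :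
  injective F -> (forall x, A x <-> exists t, x = F t) -> has_card A #|T|.
Proof.
move=> Finj FA; exists (F \o enum_val); split; first exact: inj_comp Finj enum_val_inj.
move=> x; rewrite FA; split=> [[t ->]|[i ->]]; last by exists (enum_val i).
by exists (enum_rank t); rewrite /= enum_rankK.
Qed.

Lemma has_card_ext (X : Type) (A B : X -> Prop) m :
  (forall x, A x <-> B x) -> has_card A m -> has_card B m.
Proof. by move=> AB [F [Finj FA]]; exists F; split=> // x; rewrite -AB. Qed.

Lemma has_card_image (X Y : Type) (A : X -> Prop) (B : Y -> Prop) (g : X -> Y) m :
  has_card A m -> (forall x y, A x -> A y -> g x = g y -> x = y) ->
  (forall y, B y <-> exists2 x, A x & y = g x) -> has_card B m.
Proof.
move=> [F [Finj FA]] ginj gB; exists (g \o F); split.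
  by move=> i j /ginj ij; apply: Finj; apply: ij; apply/FA; [exists i|exists j].
move=> y; rewrite gB; split=> [[x /FA[i ->] ->]|[i ->]]; first by exists i.
by exists (F i) => //; apply/FA; exists i.
Qed.

Lemma has_card_prod (J : finType) (X : J -> Type) (A : forall j, X j -> Prop)
    (m : J -> nat) :
  (forall j, has_card (A j) (m j)) ->
  has_card (fun x : forall j, X j => forall j, A j (x j)) (\prod_j m j).
Proof.
move=> /fin_all_exists[F FP].
have -> : (\prod_j m j = #|{dffun forall j, 'I_(m j)}|)%N.
  rewrite card_dep_ffun foldrE big_map big_enum; apply: eq_bigr => j _.
  by rewrite card_ord.
apply: (has_card_fin (F := fun (t : {dffun forall j, 'I_(m j)}) j => F j (t j))).
  move=> s t st; apply/ffunP => j; apply: (FP j).1.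
  by have := congr1 (fun f => f j) st.
move=> x; split=> [Ax|[t ->] j]; last by apply/(FP j).2; exists (t j).
have /fin_all_exists[t tE] : forall j, exists i, x j = F j i by move=> j; apply/(FP j).2.
by exists [ffun j => t j]; apply/functional_extensionality_dep => j; rewrite ffunE.
Qed.

Lemma has_card_eq (X : Type) (A : X -> Prop) m :
  has_card A m -> ([set x | A x] #= `I_m)%card.
Proof.
move=> [F [Finj FA]].
have -> : [set x | A x]%classic = (F @` [set: 'I_m])%classic.
  by apply/seteqP; split=> x /= => [/FA[i ->]|[i _ <-]]; [exists i | apply/FA; exists i].
apply: card_eq_trans (card_esym card_II).
by apply: inj_card_eq => i j _ _; apply: Finj.
Qed.

End Cardinality.

Lemma MLdeg_eq (K : numFieldType) k (ns : k.-tuple nat) m :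
  is_MLdeg K ns m -> MLdeg K ns = m.
Proof.
move=> hm; apply: xget_unique => // m' hm'.
have [u [h h']] := generic_exists (generic_and hm hm').
by apply/card_eq_II; apply: card_eq_trans h; apply: card_esym.
Qed.

Lemma is_MLdegI (K : numClosedFieldType) k (ns : k.-tuple nat) m :
  generic (fun u : 'cV[K]_#|edge ns| => has_card (likelihood_solution u) m) ->
  is_MLdeg K ns m.
Proof.
move=> /generic_polyfun[F [Fp Fu FP]]; apply/generic_polyfun.
by exists F; split=> // u /FP/has_card_eq.
Qed.

Local Notation coord := Defs.coord.

Section Coordinates.
Variables (K : numClosedFieldType) (k : nat) (ns : k.-tuple nat).
Local Notation vertex := (vertex ns).
Local Notation edge := (edge ns).
Implicit Types (p u : 'cV[K]_#|edge|) (w : vertex -> vertex -> K).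

Lemma coord_sym p x y : coord p x y = coord p y x.
Proof. by rewrite /coord setUC. Qed.

Lemma coord_diag p x : coord p x x = 0.
Proof. by rewrite /coord insubF // setUid cards1. Qed.

Lemma coord_edge p (e : edge) x y : val e = [set x; y] ->
  coord p x y = p (enum_rank e) ord0.
Proof. by move=> exy; rewrite /coord -exy valK. Qed.

Lemma edge_pair (e : edge) : exists x y, x != y /\ val e = [set x; y].
Proof. by have /cards2P[x [y [xy exy]]] := valP e; exists x, y. Qed.

Lemma pair_edge (x y : vertex) : x != y -> exists e : edge, val e = [set x; y].
Proof.
move=> xy; have h : #|[set x; y]| == 2%N by rewrite cards2 xy.
by exists (exist _ [set x; y] h).
Qed.

Lemma coord_inj p u : (forall x y, coord p x y = coord u x y) -> p = u.
Proof.
move=> pu; apply/colP => c; have [x [y [_ e]]] := edge_pair (enum_val c).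
by have := pu x y; rewrite !(coord_edge _ e) enum_valK.
Qed.

Lemma coord_surj w : (forall x y, w x y = w y x) -> (forall x, w x x = 0) ->
  exists p, coord p = w.
Proof.
move=> ws wd.
have /boolp.choice[f fE] : forall c : 'I_#|edge|, exists z, forall x y,
    val (enum_val c) = [set x; y] -> w x y = z.
  move=> c; have [x [y [xy e]]] := edge_pair (enum_val c); exists (w x y) => x' y'.
  rewrite e => e'; have : x \in [set x'; y'] by rewrite -e' set21.
  have : y \in [set x'; y'] by rewrite -e' set22.
  have : x' != y' by have := cards2 x' y'; rewrite -e' cards2 xy; case: eqP.
  rewrite !inE => xy' /orP[]/eqP yE /orP[]/eqP xE; move: xy; rewrite ?xE ?yE ?eqxx //.
exists (\col_c f c); apply/funext => x; apply/funext => y.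
have [->|xy] := eqVneq x y; first by rewrite coord_diag wd.
have [e exy] := pair_edge xy; rewrite (coord_edge _ exy) mxE.
by apply/esym/fE; rewrite enum_rankK.
Qed.

Lemma polyfun_coord x y : polyfun (fun p => coord p x y).
Proof.
have [->|xy] := eqVneq x y.
  have [f fE] := @polyfun_const K #|edge| 0; exists f => p; rewrite -fE; exact: coord_diag.
have [e exy] := pair_edge xy; have [f fE] := polyfun_coef K (enum_rank e).
by exists f => p; rewrite -fE; apply: coord_edge.
Qed.

Lemma set2_eq (T : finType) (a b x y : T) :
  ([set x; y] == [set a; b]) = (x == a) && (y == b) || (x == b) && (y == a).
Proof.
apply/eqP/orP => [e|[]/andP[/eqP-> /eqP->] //]; last by rewrite setUC.
have : x \in [set a; b] by rewrite -e set21.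
have : y \in [set a; b] by rewrite -e set22.
have : a \in [set x; y] by rewrite e set21.
have : b \in [set x; y] by rewrite e set22.
rewrite !inE ![a == _]eq_sym ![b == _]eq_sym.
by move: (x == a) (x == b) (y == a) (y == b) => [] [] [] [] //; auto.
Qed.

(** Every edge is the set of endpoints of exactly two ordered pairs. *)
Lemma sum_pairs p (F : {set vertex} -> K) :
  \sum_x \sum_y F [set x; y] * coord p x y =
  2 * \sum_c F (val (enum_val c)) * p c ord0.
Proof.
pose G (c : 'I_#|edge|) := F (val (enum_val c)) * p c ord0.
have E x y : F [set x; y] * coord p x y =
    \sum_c (val (enum_val c) == [set x; y])%:R * G c.
  have [->|xy] := eqVneq x y.
    rewrite coord_diag mulr0 big1 // => c _; have [a [b [ab ->]]] := edge_pair (enum_val c).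
    rewrite set2_eq orbb; case: (a =P y) => [ay|_]; last by rewrite mul0r.
    by rewrite -ay eq_sym (negPf ab) mul0r.
  have [e exy] := pair_edge xy; rewrite (coord_edge _ exy) -exy.
  rewrite (bigD1 (enum_rank e)) //= /G enum_rankK eqxx mul1r big1 ?addr0 // => c ce.
  case: eqP => [h|_]; last by rewrite mul0r.
  by case/eqP: ce; rewrite -(val_inj h) enum_valK.
rewrite (eq_bigr _ (fun x _ => eq_bigr _ (fun y _ => E x y))).
rewrite (eq_bigr _ (fun x _ => exchange_big _ _ _ _ _ _)) exchange_big /= mulr_sumr.
apply: eq_bigr => c _; rewrite -/(G c).
have [a [b [ab ->]]] := edge_pair (enum_val c).
transitivity (\sum_x \sum_y ((x == a)%:R * (y == b)%:R + (x == b)%:R * (y == a)%:R) * G c).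
  apply: eq_bigr => x _; apply: eq_bigr => y _; congr (_ * _).
  rewrite eq_sym set2_eq -!natrM -natrD !mulnb; congr _%:R.
  by case: eqP => [->|]; rewrite ?(negPf ab) //= ?addn0 ?orbF.
have d1 (z : vertex) : \sum_x (x == z)%:R = 1 :> K.
  by rewrite (bigD1 z) //= eqxx big1 ?addr0 // => x /negPf->.
under eq_bigr => x _ do rewrite -mulr_suml big_split /= -!mulr_sumr !d1 !mulr1.
by rewrite -mulr_suml big_split /= !d1; congr (_ * _); ring.
Qed.

Lemma coordB p u x y : coord (p - u) x y = coord p x y - coord u x y.
Proof.
have [->|xy] := eqVneq x y; first by rewrite !coord_diag subr0.
have [e exy] := pair_edge xy.
by rewrite !(coord_edge _ exy) !mxE.
Qed.

Lemma weighting_coord p : weighting (coord p).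
Proof. by split=> [x y|x]; [apply: coord_sym | apply: coord_diag]. Qed.

Definition block_sum w (i j : 'I_k) : K :=
  \sum_(x : vertex | tag x == i) \sum_(y : vertex | tag y == j) w x y.

Lemma block_sumC w i j : weighting w -> block_sum w i j = block_sum w j i.
Proof.
by move=> [ws _]; rewrite /block_sum exchange_big; apply: eq_bigr => x _; apply: eq_bigr.
Qed.

Definition incident (r : param ns) (s : {set vertex}) : bool :=
  match r with
  | inl x => x \in s
  | inr b => val b == [set tag x | x in s]
  end.

Arguments incident : simpl never.

Lemma design_row p r :
  2 * (design K ns *m p) (enum_rank r) ord0 =
  \sum_x \sum_y (incident r [set x; y])%:R * coord p x y.
Proof.
rewrite (sum_pairs p (fun s => (incident r s)%:R)) mxE; congr (_ * _).
by apply: eq_bigr => c _; rewrite mxE enum_rankK; case: r.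
Qed.

Lemma incident_vertex w z : weighting w ->
  \sum_x \sum_y (incident (inl z) [set x; y])%:R * w x y = 2 * degree w z.
Proof.
move=> [ws wd].
have E x y : (incident (inl z) [set x; y])%:R * w x y =
    (x == z)%:R * w z y + (y == z)%:R * w z x.
  rewrite /incident !inE [z == x]eq_sym [z == y]eq_sym.
  case: (x =P z) => [->|_]; case: (y =P z) => [->|_] /=;
    by rewrite ?wd ?mul0r ?mul1r ?addr0 ?add0r // ws.
have d1 (x : vertex) : \sum_y (y == x)%:R = 1 :> K.
  by rewrite (bigD1 x) //= eqxx big1 ?addr0 // => y /negPf->.
under eq_bigr => x _ do
  (rewrite (eq_bigr _ (fun y _ => E x y)) big_split /= -mulr_sumr -mulr_suml d1 mul1r).
by rewrite big_split /= -mulr_suml d1 mul1r -/(degree w z); ring.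
Qed.

Lemma incident_block w (b : block_pair k) i j : val b = [set i; j] -> weighting w ->
  \sum_x \sum_y (incident (inr b) [set x; y])%:R * w x y =
  (if i == j then 1 else 2) * block_sum w i j.
Proof.
move=> bij wP; have E (x y : vertex) : (incident (inr b) [set x; y]) =
    (tag x == i) && (tag y == j) || (tag x == j) && (tag y == i).
  by rewrite /incident imsetU1 imset_set1 bij eq_sym set2_eq.
have S (i' j' : 'I_k) : block_sum w i' j' =
    \sum_x \sum_y ((tag x == i') && (tag y == j'))%:R * w x y.
  rewrite /block_sum big_mkcond; apply: eq_bigr => x _; case: eqP => _ /=.
    by rewrite big_mkcond; apply: eq_bigr => y _; case: eqP; rewrite ?mul1r ?mul0r.
  by rewrite big1 // => y _; rewrite mul0r.
case: (i =P j) => [ij|/eqP ij].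
  by rewrite mul1r S; apply: eq_bigr => x _; apply: eq_bigr => y _; rewrite E ij orbb.
rewrite mulr_natl mulr2n {2}block_sumC // !S -big_split; apply: eq_bigr => x _ /=.
rewrite -big_split; apply: eq_bigr => y _ /=; rewrite -mulrDl -natrD E; congr (_%:R * _).
case: (tag x =P i) => [->|_] /=; last by rewrite ?add0n.
by rewrite (negPf ij) /= orbF addn0.
Qed.

(** Sums over ordered pairs count every edge twice, which is harmless in
    characteristic 0; this replaces the rows of the matrix by vertex sums and
    block sums. *)
Lemma designP p u : design K ns *m (p - u) = 0 <->
  degree (coord p) =1 degree (coord u) /\
  forall i j, block_sum (coord p) i j = block_sum (coord u) i j.
Proof.
have wpu := weighting_coord (p - u).
have dB x : degree (coord (p - u)) x = degree (coord p) x - degree (coord u) x.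
  by rewrite /degree -sumrB; apply: eq_bigr => y _; apply: coordB.
have bB i j : block_sum (coord (p - u)) i j =
    block_sum (coord p) i j - block_sum (coord u) i j.
  rewrite /block_sum -sumrB; apply: eq_bigr => x _; rewrite -sumrB.
  by apply: eq_bigr => y _; apply: coordB.
split=> [h|[hd hb]].
  have hr r : \sum_x \sum_y (incident r [set x; y])%:R * coord (p - u) x y = 0.
    by rewrite -design_row h mxE mulr0.
  split=> [x|i j].
    have := hr (inl x); rewrite incident_vertex // dB => /eqP.
    by rewrite mulf_eq0 pnatr_eq0 /= subr_eq0 => /eqP.
  have c : (0 < #|[set i; j]| <= 2)%N by rewrite cards2; case: (i != j).
  have := hr (inr (exist _ [set i; j] c)); rewrite (@incident_block _ _ i j) // bB => /eqP.
  by rewrite mulf_eq0 subr_eq0 => /orP[|/eqP //]; case: (i == j); rewrite ?oner_eq0 ?pnatr_eq0.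
apply/colP => c; rewrite -[c]enum_valK [RHS]mxE; move: (enum_val c) => r.
have : 2 * (design K ns *m (p - u)) (enum_rank r) ord0 = 0.
  rewrite design_row; case: r => [x|b].
    by rewrite incident_vertex // dB hd subrr mulr0.
  have [i [j bij]] : exists i j, val b = [set i; j].
    have /andP[b0] := valP b; rewrite leq_eqVlt.
    case/orP => [/cards2P[i [j [_ ->]]]|b1]; first by exists i, j.
    have /cards1P[i ->] : #|val b| == 1%N by rewrite eqn_leq -ltnS b1.
    by exists i, i; rewrite setUid.
  by rewrite (incident_block bij) // bB hb subrr mulr0.
by move/eqP; rewrite mulf_eq0 pnatr_eq0 => /eqP.
Qed.

Lemma has_card_coord (Q : (vertex -> vertex -> K) -> Prop) m :
  has_card (fun w => weighting w /\ Q w) m -> has_card (fun p => Q (coord p)) m.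
Proof.
move=> [F [Finj FQ]].
have /boolp.choice[G GE] : forall i, exists p, coord p = F i.
  move=> i; have [[ws wd] _] : weighting (F i) /\ Q (F i) by apply/FQ; exists i.
  exact: coord_surj.
exists G; split; first by move=> i j ij; apply: Finj; rewrite -!GE ij.
move=> p; split=> [Qp|[i ->]]; last first.
  by rewrite GE; apply: (fun h => (iffRL (FQ _) h).2); exists i.
have [i pi] := iffLR (FQ (coord p)) (conj (weighting_coord p) Qp).
by exists i; apply: coord_inj => x y; rewrite GE pi.
Qed.

Lemma vtx_inj (i : 'I_k) : injective (vtx (ns := ns) (i := i)).
Proof. by move=> a b /eqP; rewrite eq_Tagged => /eqP. Qed.

Lemma vertex_sum (F : vertex -> K) (i : 'I_k) :
  \sum_(x : vertex | tag x == i) F x = \sum_(s : 'I_(tnth ns i)) F (vtx s).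
Proof.
transitivity (\sum_(j | j == i) \sum_(s : 'I_(tnth ns j)) F (vtx s)).
  by rewrite sig_big_dep /=; apply: eq_big => [x|x _]; rewrite ?andbT //; case: x.
by rewrite big_pred1_eq.
Qed.

End Coordinates.

(** * Blocks *)

Section SingleBlock.
Variables (K : numClosedFieldType) (ns : 1.-tuple nat).
Implicit Types (p u : 'cV[K]_#|edge ns|).

Lemma vertex1E (x : vertex ns) : exists s, x = vtx (i := ord0) s.
Proof. by case: x => i s; rewrite (ord1 i) in s *; exists s. Qed.

(** With one block the remaining row is half the sum of the vertex rows. *)
Lemma single_block_solution u p :
  likelihood_solution u p <-> complete_solution (degree (coord u)) (coord p).
Proof.
have tagE (i j : 'I_1) : (i != j) = false by rewrite !ord1 eqxx.
split=> [[/designP[dp _] qw _ _ _]|[wp dp qp]].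
  split=> //; first exact: weighting_coord.
  move=> t z v w; have [t' ->] := vertex1E t; have [z' ->] := vertex1E z.
  have [v' ->] := vertex1E v; have [w' ->] := vertex1E w => un.
  apply/eqP; rewrite -subr_eq0; apply/eqP; apply: qw.
  by rewrite -(map_inj_uniq (@vtx_inj _ ns _)).
split.
- apply/designP; split=> // i j.
  have bE (w : vertex ns -> vertex ns -> K) : block_sum w i j = \sum_x degree w x.
    rewrite /block_sum; apply: eq_big => [x|x _]; first by rewrite !ord1 eqxx.
    by apply: eq_bigl => y; rewrite !ord1 eqxx.
  by rewrite !bE; apply: eq_bigr => x _; apply: dp.
- move=> i t z v w un; apply/eqP; rewrite subr_eq0; apply/eqP; apply: qp.
  by rewrite -(map_inj_uniq (@vtx_inj _ ns i)) in un.
- by move=> i j t z v w; rewrite tagE.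
- by move=> i j t z v w; rewrite tagE.
- by move=> i j l t z v w; rewrite /= inE negb_or tagE.
Qed.

Lemma single_block_MLdeg : (1 < #|vertex ns|)%N ->
  is_MLdeg K ns (complete_mldeg #|vertex ns|).
Proof.
move=> V1; apply: is_MLdegI.
have [f [[w [[ws wd] fw]] fP]] := complete_generic K V1.
apply/generic_polyfun; exists (fun u => f.@[degree (coord u) \o enum_val]); split.
- apply: polyfun_comp => i; apply: polyfun_sum => y; exact: polyfun_coord.
- by have [u uw] := coord_surj ws wd; exists u; rewrite uw.
move=> u /(fP _ (weighting_coord u)) h.
have : has_card (fun w => weighting w /\ complete_solution (degree (coord u)) w)
    (complete_mldeg #|vertex ns|).
  by apply: has_card_ext h => x; split=> [|[]//] h; split=> //; case: h.
move=> /has_card_coord; apply: has_card_ext => p; split; by move/single_block_solution.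
Qed.

End SingleBlock.

Section Product.
Variables (K : numClosedFieldType) (k : nat) (ns : k.-tuple nat).
Local Notation vertex := (vertex ns).
Local Notation n_ i := (tnth ns i).
Implicit Types (w c : vertex -> vertex -> K) (i j l : 'I_k).

(** The complement of the block i becomes the vertex None. *)
Definition contract w i : option 'I_(n_ i) -> option 'I_(n_ i) -> K :=
  fun a b => match a, b with
  | Some s, Some t => w (vtx s) (vtx t)
  | Some s, None | None, Some s => \sum_(y : vertex | tag y != i) w (vtx s) y
  | None, None => 0
  end.
Arguments contract : clear implicits.
Arguments contract w i a b : simpl never.

Lemma weighting_contract w i : weighting w -> weighting (contract w i).
Proof. by move=> [ws wd]; split=> [[s|] [t|]|[s|]] //=; [exact: ws | exact: wd]. Qed.

Lemma big_option_sum (T : finType) (F : option T -> K) :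
  \sum_a F a = F None + \sum_s F (Some s).
Proof.
rewrite (bigD1 None) //=; congr (_ + _).
rewrite (eq_bigl (fun a => a \in [set Some s | s : T])) => [|[s|]].
- by rewrite big_imset //= => s t _ _ [].
- by rewrite imset_f.
- by apply/esym/imsetP => -[].
Qed.

Lemma degree_contract_Some w i (s : 'I_(n_ i)) :
  degree (contract w i) (Some s) = degree w (vtx s).
Proof.
rewrite /degree big_option_sum addrC [RHS](bigID (fun y => tag y == i)) /=.
by rewrite vertex_sum.
Qed.

(** Grouping by blocks turns sums over the complement of a block into block
    sums, which the linear equations control. *)
Lemma sum_other_blocks (F : vertex -> K) i :
  \sum_(y | tag y != i) F y = \sum_(j | j != i) \sum_(y | tag y == j) F y.
Proof.
rewrite (partition_big tag (fun j => j != i)) //; apply: eq_bigr => j ji.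
by apply: eq_bigl => y; case: (tag y =P j) => [->|_]; rewrite ?ji ?andbF.
Qed.

Lemma degree_contract_None w i :
  degree (contract w i) None = \sum_(j | j != i) block_sum w i j.
Proof.
rewrite /degree big_option_sum add0r.
rewrite -(vertex_sum (fun x => \sum_(y | tag y != i) w x y)).
under eq_bigr => x _ do rewrite sum_other_blocks.
by rewrite exchange_big.
Qed.

Definition model_quadrics w : Prop :=
  [/\ forall i (t u v z : 'I_(n_ i)), uniq [:: t; u; v; z] ->
        w (vtx t) (vtx u) * w (vtx v) (vtx z) = w (vtx t) (vtx v) * w (vtx u) (vtx z),
      forall i j (t u v : 'I_(n_ i)) (z : 'I_(n_ j)), i != j -> uniq [:: t; u; v] ->
        w (vtx t) (vtx z) * w (vtx u) (vtx v) = w (vtx t) (vtx u) * w (vtx v) (vtx z),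
      forall i j (t u : 'I_(n_ i)) (v z : 'I_(n_ j)), i != j -> t != u -> v != z ->
        w (vtx t) (vtx v) * w (vtx u) (vtx z) = w (vtx t) (vtx z) * w (vtx u) (vtx v)
    & forall i j l (t u : 'I_(n_ i)) (v : 'I_(n_ j)) (z : 'I_(n_ l)),
        uniq [:: i; j; l] -> t != u ->
        w (vtx t) (vtx v) * w (vtx u) (vtx z) = w (vtx t) (vtx z) * w (vtx u) (vtx v)].

Definition model_solution c w : Prop :=
  [/\ degree w =1 degree c, forall i j, block_sum w i j = block_sum c i j
    & model_quadrics w].

Lemma likelihood_solutionE (u p : 'cV[K]_#|edge ns|) :
  likelihood_solution u p <-> model_solution (coord u) (coord p).
Proof.
split=> [[/designP[dp bp] q1 q2 q3 q4]|[dp bp [q1 q2 q3 q4]]]; split=> //.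
- by split=> *; apply/eqP; rewrite -subr_eq0; apply/eqP;
    [apply: q1 | apply: q2 | apply: q3 | apply: q4].
- exact/designP.
- by move=> *; apply/eqP; rewrite subr_eq0; apply/eqP; apply: q1.
- by move=> *; apply/eqP; rewrite subr_eq0; apply/eqP; apply: q2.
- by move=> *; apply/eqP; rewrite subr_eq0; apply/eqP; apply: q3.
- by move=> *; apply/eqP; rewrite subr_eq0; apply/eqP; apply: q4.
Qed.

(** The 2-2 and 2-1-1 equations together, with the trivial cases s = s' and
    y = y'. *)
Lemma rank1_block w i (s s' : 'I_(n_ i)) (y y' : vertex) : model_quadrics w ->
  tag y != i -> tag y' != i ->
  w (vtx s) y * w (vtx s') y' = w (vtx s) y' * w (vtx s') y.
Proof.
move=> [_ _ q22 q211]; case: y y' => [j t] [l t'] /= ji li.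
have [->|ss'] := eqVneq s s'; first by rewrite mulrC.
have [jl|jl] := eqVneq j l.
  subst l; have [->|tt'] := eqVneq t t'; first by [].
  by apply: q22 => //; rewrite eq_sym.
by apply: q211 => //; rewrite /= !inE negb_or ![i == _]eq_sym ji li jl.
Qed.

(** A quadric through None is a sum of 3-1 equations over the contracted
    vertices. *)
Lemma quadrics_contract w i : weighting w -> model_quadrics w ->
  quadrics (contract w i).
Proof.
move=> [ws wd] [qw q31 _ _].
have Q (t u v : 'I_(n_ i)) : uniq [:: t; u; v] ->
    contract w i (Some t) None * contract w i (Some u) (Some v) =
    contract w i (Some t) (Some u) * contract w i (Some v) None.
  move=> un; rewrite /contract /= mulr_suml mulr_sumr; apply: eq_bigr => -[j z] /= ji.
  by apply: q31 => //; rewrite eq_sym.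
have [cs cd] : weighting (contract w i) by apply: weighting_contract.
have sinj : injective (@Some 'I_(n_ i)) by move=> a b [].
have U (a b c : 'I_(n_ i)) : a != b -> a != c -> b != c -> uniq [:: a; b; c].
  by move=> ab ac bc; rewrite /= !inE negb_or ab ac bc.
move=> [t|] [u|] [v|] [z|]; rewrite /= ?inE ?orbT ?andbF //= !negb_or ?andbT.
- move=> /and3P[/and3P[tu tv tz] /andP[uv uz] vz].
  by apply: qw; rewrite /= !inE !negb_or tu tv tz uv uz vz.
- move=> /andP[/andP[tu tv] uv].
  rewrite [RHS]mulrC Q; first by rewrite (cs (Some u)).
  by apply: U => //; rewrite eq_sym.
- move=> /andP[/andP[tu tz] uz].
  by rewrite (cs None) -Q //; apply: U.
- move=> /andP[/andP[tv tz] vz].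
  by rewrite (cs None) -Q //; apply: U.
- move=> /andP[/andP[uv uz] vz].
  rewrite !(cs None) Q; last exact: U.
  by rewrite Q ?(cs (Some u) (Some v)) //; apply: U; rewrite // eq_sym.
Qed.

(** The rows of pairs of distinct blocks and of the vertices imply those of
    single blocks. *)
Lemma block_sum_diag w i : block_sum w i i =
  \sum_(s : 'I_(n_ i)) degree w (vtx s) - \sum_(j | j != i) block_sum w i j.
Proof.
rewrite -degree_contract_None /degree big_option_sum add0r -sumrB /block_sum vertex_sum.
apply: eq_bigr => s _; rewrite [\sum_y w _ y](bigID (fun y : vertex => tag y == i)) /=.
by rewrite addrK.
Qed.

Lemma sum_block_pairs w i j : block_sum w i j =
  \sum_(s : 'I_(n_ i)) \sum_(t : 'I_(n_ j)) w (vtx s) (vtx t).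
Proof. by rewrite /block_sum vertex_sum; apply: eq_bigr => s _; rewrite vertex_sum. Qed.

Section Glue.
Variable c : vertex -> vertex -> K.
Hypothesis wc : weighting c.
Let T i : K := degree (contract c i) None.
Hypothesis T_neq0 : forall i, T i != 0.

Definition family : Type := forall i, option 'I_(n_ i) -> option 'I_(n_ i) -> K.
Implicit Types P : family.

(** The inverse of contraction: the entries between two blocks are recovered from
    their row and column sums, as a matrix of rank one is. *)
Definition glue P : vertex -> vertex -> K := fun x y =>
  if tag x == tag y then P (tag x) (Some (tagged x)) (Some (tagged_as x y))
  else P (tag x) (Some (tagged x)) None * P (tag y) (Some (tagged y)) None *
       (block_sum c (tag x) (tag y) / (T (tag x) * T (tag y))).

Lemma glue_same P i (s t : 'I_(n_ i)) : glue P (vtx s) (vtx t) = P i (Some s) (Some t).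
Proof. by rewrite /glue /= eqxx tagged_asE. Qed.

Lemma glue_diff P i j (s : 'I_(n_ i)) (t : 'I_(n_ j)) : i != j ->
  glue P (vtx s) (vtx t) =
  P i (Some s) None * P j (Some t) None * (block_sum c i j / (T i * T j)).
Proof. by rewrite /glue /= => /negPf ->. Qed.

Lemma weighting_glue P : (forall i, weighting (P i)) -> weighting (glue P).
Proof.
move=> wP; split=> [[i s] [j t]|[i s]]; last by rewrite glue_same (wP i).2.
have [ij|ij] := eqVneq i j; first by subst j; rewrite !glue_same (wP i).1.
have ji : j != i by rewrite eq_sym.
rewrite !glue_diff // [block_sum c j i]block_sumC // [T j * _]mulrC.
by congr (_ * _); rewrite mulrC.
Qed.

Lemma sum_to_None P i : weighting (P i) ->
  \sum_s P i (Some s) None = degree (P i) None.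
Proof.
move=> [ps pd]; rewrite /degree big_option_sum pd add0r.
by apply: eq_bigr => s _; rewrite ps.
Qed.

(** Since the sum over j <> i of alpha_ij is T_i, summing a glued entry over the
    complement of the block i gives back P_i(t, None). *)
Lemma contract_glue P :
  (forall i, complete_solution (degree (contract c i)) (P i)) ->
  forall i, contract (glue P) i = P i.
Proof.
move=> solP i; have [wP dP _] := solP i; have [ps pd] := wP.
have toNone (s : 'I_(n_ i)) :
    \sum_(y : vertex | tag y != i) glue P (vtx s) y = P i (Some s) None.
  rewrite sum_other_blocks.
  under eq_bigr => j ji.
    rewrite vertex_sum.
    have ij : i != j by rewrite eq_sym.
    under eq_bigr => t _ do rewrite glue_diff //.
    rewrite -mulr_suml -mulr_sumr sum_to_None; last by have [] := solP j.
    have [_ -> _] := solP j; rewrite -/(T j).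
    have -> : P i (Some s) None * T j * (block_sum c i j / (T i * T j)) =
      P i (Some s) None / T i * block_sum c i j by field; rewrite !T_neq0.
    over.
  by rewrite -mulr_sumr -degree_contract_None -/(T i) divfK.
apply/funext => -[s|]; apply/funext => -[t|] //.
- exact: glue_same.
- exact: toNone.
- by rewrite [LHS]toNone ps.
Qed.

Lemma glue_solution P :
  (forall i, complete_solution (degree (contract c i)) (P i)) ->
  weighting (glue P) /\ model_solution c (glue P).
Proof.
move=> solP; have wP i : weighting (P i) by have [] := solP i.
have qP i : quadrics (P i) by have [] := solP i.
have sumN i : \sum_s P i (Some s) None = T i.
  by rewrite sum_to_None //; have [_ ->] := solP i.
have dg x : degree (glue P) x = degree c x.
  case: x => i s; rewrite -[LHS]degree_contract_Some contract_glue //.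
  by have [_ -> _] := solP i; rewrite degree_contract_Some.
have off i j : i != j -> block_sum (glue P) i j = block_sum c i j.
  move=> ij; rewrite sum_block_pairs.
  under eq_bigr => s _ do under eq_bigr => t _ do rewrite glue_diff //.
  under eq_bigr => s _ do rewrite -mulr_suml -mulr_sumr sumN.
  by rewrite -!mulr_suml sumN; field; rewrite !T_neq0.
have sinj i : injective (@Some 'I_(n_ i)) by move=> a b [].
have U i (a b z : 'I_(n_ i)) : uniq [:: a; b; z] ->
    P i (Some a) None * P i (Some b) (Some z) = P i (Some a) (Some b) * P i (Some z) None.
  move=> un; have -> : P i (Some z) None = P i None (Some z) by rewrite (wP i).1.
  apply: qP; move: un; rewrite /= !inE /= !negb_or => /andP[/andP[ab az]].
  by rewrite !andbT => bz; rewrite -!(inj_eq (@sinj i)) in ab az bz; rewrite ab az bz.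
split; first exact: weighting_glue.
split=> // [i j|].
  have [<-|] := eqVneq i j; last exact: off.
  rewrite !block_sum_diag; congr (_ - _); first by apply: eq_bigr => s _; apply: dg.
  by apply: eq_bigr => l li; apply: off; rewrite eq_sym.
split.
- move=> i t u v z un; rewrite !glue_same; apply: qP.
  by rewrite -(map_inj_uniq (@sinj i)) in un.
- move=> i j t u v z ij un; rewrite !glue_same !glue_diff //.
  transitivity ((P i (Some t) None * P i (Some u) (Some v)) *
     (P j (Some z) None * (block_sum c i j / (T i * T j)))); first by ring.
  by rewrite U //; ring.
- by move=> i j t u v z ij _ _; rewrite !glue_diff //; ring.
- move=> i j l t u v z; rewrite /= !inE negb_or => /andP[/andP[ij il] _] _.
  by rewrite !glue_diff //; ring.
Qed.

Lemma contract_solution w : weighting w -> model_solution c w ->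
  forall i, complete_solution (degree (contract c i)) (contract w i).
Proof.
move=> ww [dw bw qw] i; split; [exact: weighting_contract | | exact: quadrics_contract].
move=> [s|]; first by rewrite !degree_contract_Some.
by rewrite !degree_contract_None; apply: eq_bigr => j _; apply: bw.
Qed.

(** By rank one for the block i, w(s,y) T_i = R_i(s) C_i(y) with R_i the sums
    along the complement and C_i those along the block.  Rank one for the block j
    of y, summed over the block i, gives C_i(y) T_j = R_j(y) alpha_ij. *)
Lemma glue_contract w : weighting w -> model_solution c w -> glue (contract w) = w.
Proof.
move=> ww sol; have [ws wd] := ww; have [dw bw qw] := sol.
apply/funext => -[i s]; apply/funext => -[j t].
have [ij|ij] := eqVneq i j; first by subst j; rewrite glue_same.
rewrite glue_diff //.
pose R l (s : 'I_(n_ l)) := contract w l (Some s) None.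
have sumR l : \sum_s R l s = T l.
  rewrite sum_to_None; last exact: weighting_contract.
  by have [_ ->] := contract_solution ww sol l.
have E l (a : 'I_(n_ l)) (y : vertex) : tag y != l ->
    w (vtx a) y * T l = R l a * \sum_(b : 'I_(n_ l)) w (vtx b) y.
  move=> yl; rewrite -sumR mulr_sumr [RHS]mulr_sumr; apply: eq_bigr => b _.
  rewrite /R /contract mulr_sumr mulr_suml; apply: eq_bigr => z zl.
  exact: rank1_block.
have E1 := E i s (vtx t); have E2 := fun b => E j t (vtx (i := i) b).
have Et : (\sum_b w (vtx (i := i) b) (vtx t)) * T j = R j t * block_sum c i j.
  rewrite mulr_suml.
  under eq_bigr => b _ do rewrite ws E2 //.
  by rewrite -mulr_sumr exchange_big -bw block_sumC // sum_block_pairs.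
have E3 : w (vtx s) (vtx t) * (T i * T j) = R i s * R j t * block_sum c i j.
  have ji : j != i by rewrite eq_sym.
  by rewrite mulrA E1 // -!mulrA Et.
rewrite -/(R i s) -/(R j t) mulrA -E3 mulfK // mulf_neq0 //; exact: T_neq0.
Qed.

Lemma model_count (D : 'I_k -> nat) :
  (forall i, has_card (complete_solution (degree (contract c i))) (D i)) ->
  has_card (fun w => weighting w /\ model_solution c w) (\prod_i D i).
Proof.
move=> /has_card_prod h; apply: (has_card_image (g := glue) h).
- move=> P Q solP solQ PQ; apply/functional_extensionality_dep => i.
  by rewrite -(contract_glue solP) -(contract_glue solQ) PQ.
move=> w; split=> [[ww sol]|[P solP ->]]; last exact: glue_solution.
by exists (contract w); [exact: contract_solution | rewrite glue_contract].
Qed.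

End Glue.

Section Generic.
Hypotheses (k_gt1 : (1 < k)%N) (n_gt0 : forall i, (0 < n_ i)%N).

(** Put the weight of the edges to None on the edges to one fixed vertex of another
    block. *)
Lemma contract_surj i (p : option 'I_(n_ i) -> option 'I_(n_ i) -> K) :
  weighting p -> exists2 w, weighting w & contract w i = p.
Proof.
move=> [ps pd]; pose s0 : 'I_(n_ i) := Ordinal (n_gt0 i).
have [j ji] : exists j, j != i.
  have /card_gt0P[j] : (0 < #|[set~ i]|)%N by rewrite cardsC1 card_ord -subn1 subn_gt0.
  by rewrite !inE; exists j.
pose y0 : vertex := vtx (Ordinal (n_gt0 j)).
pose h (x : vertex) : option (option 'I_(n_ i)) :=
  if tag x == i then Some (Some (tagged_as (vtx s0) x))
  else if x == y0 then Some None else None.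
have hs s : h (vtx s) = Some (Some s) by rewrite /h /= eqxx tagged_asE.
have hy y : tag y != i -> h y = if y == y0 then Some None else None.
  by rewrite /h => /negPf ->.
pose w x y := match h x, h y with Some a, Some b => p a b | _, _ => 0 end.
have wN s : \sum_(y | tag y != i) w (vtx s) y = p (Some s) None.
  rewrite (bigD1 y0) //= big1 ?addr0 => [|y /andP[yi yy]].
    by rewrite /w hs hy // eqxx.
  by rewrite /w hs hy // (negPf yy).
exists w.
  split=> [x y|x]; rewrite /w; first by case: (h x) (h y) => [a|] [b|].
  by case: (h x).
apply/funext => -[s|]; apply/funext => -[t|].
- by rewrite /contract /w !hs.
- exact: wN.
- by rewrite ps; apply: wN.
- by rewrite pd.
Qed.

Lemma polyfun_degree_contract i a :
  polyfun (fun u : 'cV[K]_#|edge ns| => degree (contract (coord u) i) a).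
Proof.
apply: polyfun_sum => b; case: a b => [s|] [t|].
- exact: polyfun_coord.
- by apply: polyfun_sum => y; apply: polyfun_coord.
- by apply: polyfun_sum => y; apply: polyfun_coord.
- exact: polyfun_const.
Qed.

Lemma generic_contract i : generic (fun u : 'cV[K]_#|edge ns| =>
  degree (contract (coord u) i) None != 0 /\
  has_card (complete_solution (degree (contract (coord u) i))) (complete_mldeg (n_ i).+1)).
Proof.
have lift p : weighting p -> exists u, contract (coord u) i = p.
  by move=> /contract_surj[w [ws wd] <-]; have [u <-] := coord_surj ws wd; exists u.
apply: generic_and; apply/generic_polyfun.
  exists (fun u => degree (contract (coord u) i) None); split=> //.
    exact: polyfun_degree_contract.
  have [|u uE] := lift (fun a b => (a != b)%:R).
    by split=> [a b|a]; rewrite ?eqxx // eq_sym.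
  exists u; rewrite uE /degree big_option_sum eqxx add0r.
  by rewrite (eq_bigr (fun=> 1)) // sumr_const card_ord pnatr_eq0 -lt0n.
have V1 : (1 < #|{: option 'I_(n_ i)}|)%N by rewrite card_option card_ord ltnS.
have [f [[p [wp fp]] fP]] := complete_generic K V1.
exists (fun u => f.@[degree (contract (coord u) i) \o enum_val]); split.
- by apply: polyfun_comp => j; apply: polyfun_degree_contract.
- by have [u uE] := lift p wp; exists u; rewrite uE.
move=> u fu; have := fP _ (weighting_contract i (weighting_coord u)) fu.
by rewrite card_option card_ord.
Qed.

Lemma product_MLdeg : is_MLdeg K ns (\prod_i complete_mldeg (n_ i).+1).
Proof.
apply: is_MLdegI.
have /generic_polyfun[F [Fp Fu FP]] := generic_all generic_contract.
apply/generic_polyfun; exists F; split=> // u /FP h.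
have := model_count (weighting_coord u) (fun i => (h i).1) (fun i => (h i).2).
move=> /has_card_coord; apply: has_card_ext => p.
by split; move/likelihood_solutionE.
Qed.

End Generic.

End Product.

Section Final.
Variable K : numClosedFieldType.

Lemma card_vertex k (ns : k.-tuple nat) : #|vertex ns| = (\sum_i tnth ns i)%N.
Proof.
by rewrite card_tagged sumnE big_map big_enum; apply: eq_bigr => i _; rewrite card_ord.
Qed.

Lemma MLdeg_one_block n : (1 < n)%N -> MLdeg K [tuple n] = complete_mldeg n.
Proof.
move=> n1; have cn : #|vertex [tuple n]| = n by rewrite card_vertex big_ord1.
by apply: MLdeg_eq; rewrite -[n in complete_mldeg n]cn; apply: single_block_MLdeg; rewrite cn.
Qed.

Lemma MLdeg_blocks k (ns : k.-tuple nat) : (1 < k)%N -> (forall i, 0 < tnth ns i)%N ->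
  MLdeg K ns = (\prod_i complete_mldeg (tnth ns i).+1)%N.
Proof. by move=> k1 n0; apply: MLdeg_eq; apply: product_MLdeg. Qed.

Lemma MLdeg_block_and_vertex n : (0 < n)%N -> MLdeg K [tuple n; 1%N] = complete_mldeg n.+1.
Proof.
move=> n0; rewrite MLdeg_blocks //; last by case=> -[|[|]].
by rewrite !big_ord_recl big_ord0 /= !muln1.
Qed.

End Final.

Local Close Scope ring_scope.

Theorem theorem3p1 (R : realType) (n k : nat) (ns : k.-tuple nat)
    (hn : 1 < n) (hk : 1 < k) (hns : forall i : 'I_k, 0 < tnth ns i) :
  [/\ (n = 2 -> MLdeg R[i] [tuple n] = 1)
        /\ (2 < n -> MLdeg R[i] [tuple n] = 2 ^ (n - 1) - n),
      forall n1 : nat, 0 < n1 ->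
        MLdeg R[i] [tuple n1; 1] = MLdeg R[i] [tuple n1 + 1]
    & MLdeg R[i] ns = \prod_(i < k) MLdeg R[i] [tuple tnth ns i; 1]].
Proof.
split.
- split=> n2; rewrite (MLdeg_one_block _ hn) /complete_mldeg; first by rewrite n2.
  by rewrite gtn_eqF.
- move=> n1 n10; rewrite MLdeg_block_and_vertex // MLdeg_one_block ?addn1 //.
- rewrite (MLdeg_blocks _ hk hns); apply: eq_bigr => i _.
  by rewrite MLdeg_block_and_vertex.
Qed.
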